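(* Let $P$ be a nonempty finite partially ordered set, $K$ a field, and $R$ the join-meet ring over $K$ arising from $P$. If $R$ is nearly Gorenstein but not Gorenstein, then the torsion number of $R$ satisfies $d(R)=1$.
   Context: Join-meet ring: let $P=\{p_1,\dots,p_n\}$ and $\hat P=P\cup\{\hat 0,\hat 1\}$, with the order of $P$ extended by $\hat 0<p_i<\hat 1$ for all $i$. $E(\hat P)$ is the set of edges of the Hasse diagram of $\hat P$: pairs $(x,y)\in\hat P\times\hat P$ with $x<y$ and no $z\in\hat P$ with $x<z<y$. To each $e\in E(\hat P)$ associate the linear form $f_e$ in the coordinates $z_0,z_1,\dots,z_n$ of $\mathbb{R}^{n+1}$: $f_e=z_i$ if $e=(p_i,\hat 1)$; $f_e=z_i-z_j$ if $e=(p_i,p_j)\in P\times P$; $f_e=z_0-z_j$ if $e=(\hat 0,p_j)$. Let $C\subset\mathbb{R}^{n+1}$ be the cone defined by $f_e\ge 0$ for all $e\in E(\hat P)$; its supporting hyperplanes are the $H_e=\{f_e=0\}$. The join-meet ring arising from $P$ is the affine semigroup ring $R=K[C\cap\mathbb{Z}^{n+1}]$. It is a normal Cohen--Macaulay domain, graded by the coordinate $z_0$ of exponent vectors, and its divisor class group $\mathrm{Cl}(R)$ is free of rank $|E(\hat P)|-(n+1)$. Its canonical module $\omega_R$ is the divisorial ideal generated by the monomials with exponent vectors in the relative interior of $C$, and $[\omega_R]$ is its class in $\mathrm{Cl}(R)$ (written additively). Nearly Gorenstein: the trace of $\omega_R$ is the ideal $\mathrm{tr}(\omega_R)=\sum_{\varphi\in\mathrm{Hom}_R(\omega_R,R)}\varphi(\omega_R)$.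 $R$ is nearly Gorenstein if $\mathrm{tr}(\omega_R)$ contains the graded maximal ideal of $R$ (the ideal generated by all monomials of positive degree). Torsion number: let $\overline{\mathrm{Cl}}(R)=\mathrm{Cl}(R)/\mathbb{Z}[\omega_R]$ and $r=\mathrm{rank}\,\overline{\mathrm{Cl}}(R)$. If $\mathrm{Fitt}_r(\mathrm{Cl}(R))=\mathrm{Fitt}_r(\overline{\mathrm{Cl}}(R))$, set $d(R)=0$; otherwise $d(R)$ is the nonnegative integer with $\mathrm{Fitt}_r(\overline{\mathrm{Cl}}(R))=(d(R))$. Here, for a finitely generated abelian group $G$ with $n$ generators and integer relation matrix $A$, $\mathrm{Fitt}_i(G)=I_{n-i}(A)\subseteq\mathbb{Z}$ is the ideal generated by the $(n-i)$-minors of $A$ (with $I_k(A)=\mathbb{Z}$ for $k\le 0$, and $I_k(A)=0$ if $A$ has no $k$-minors). *)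

(* Defs.v *)
From HB Require Import structures.
From mathcomp Require Import all_boot all_order all_algebra.
From mathcomp Require Import fraction generic_quotient.
From mathcomp Require Import boolp classical_sets.
From mathcomp Require mpoly.
From mathcomp Require Import monalg.

Set Implicit Arguments.
Unset Strict Implicit.
Unset Printing Implicit Defensive.

Import Order.TTheory GRing.Theory Num.Theory.

Local Open Scope classical_set_scope.
Local Open Scope quotient_scope.
Local Open Scope ring_scope.

Notation "x %:F" := (FracField.tofrac x) : ring_scope.

Section Ideals.
Variable R : comNzRingType.

Definition ideal_generated (S : set R) : set R :=
  [set x | exists (k : nat) (a s : 'I_k -> R),
     (forall i, S (s i)) /\ x = \sum_i a i * s i].

(* A module homomorphism I -> R is represented by any of its extensions to a
   function on R: only the values of phi on I matter. *)
Definition hom_on (I : set R) (phi : R -> R) : Prop :=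
  forall (a : R) (u v : R), I u -> I v -> phi (a * u + v) = a * phi u + phi v.

Definition trace_ideal (I : set R) : set R :=
  [set x | exists (k : nat) (phi : 'I_k -> R -> R) (w : 'I_k -> R),
     (forall i, hom_on I (phi i) /\ I (w i)) /\ x = \sum_i phi i (w i)].

Definition isomorphic_to_ring (I : set R) : Prop :=
  exists f : {linear R^o -> R^o}, injective f /\ range f = I.

End Ideals.

Section DivisorialIdeals.
Variable R : idomainType.
Local Notation F := {fraction R}.

Definition in_base (x : F) : Prop := exists a : R, x = a%:F.

Definition fractional_ideal (I : set F) : Prop :=
  [/\ I 0,
      forall x y, I x -> I y -> I (x + y),
      forall (a : R) x, I x -> I (a%:F * x),
      (exists2 x, I x & x != 0)
    & exists2 d : R, d != 0 & forall x, I x -> in_base (d%:F * x)].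

(* (R : I), the inverse of I in the field of fractions *)
Definition finv (I : set F) : set F :=
  [set x | forall y, I y -> in_base (x * y)].

(* (R : (R : I)), the smallest divisorial ideal containing I *)
Definition vclosure (I : set F) : set F := finv (finv I).

Definition divisorial (I : set F) : Prop :=
  fractional_ideal I /\ vclosure I = I.

Definition fscale (c : F) (I : set F) : set F := [set c * x | x in I].

(* The set of products x y; it need not be an ideal, but it has the same
   divisorial closure as the ideal it generates. *)
Definition fprod (I J : set F) : set F := [set x * y | x in I & y in J].

Lemma in_baseD x y : in_base x -> in_base y -> in_base (x + y).
Proof. by move=> [a ->] [b ->]; exists (a + b); rewrite rmorphD. Qed.

Lemma in_baseM x y : in_base x -> in_base y -> in_base (x * y).
Proof. by move=> [a ->] [b ->]; exists (a * b); rewrite rmorphM. Qed.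

Lemma in_base_tofrac a : in_base a%:F.
Proof. by exists a. Qed.

Lemma frac_denom (x : F) : exists2 b : R, b != 0 & in_base (b%:F * x).
Proof.
elim/quotW: x => x; exists \d_x; first exact: denom_ratioP.
exists \n_x; rewrite !piE; apply/eqmodP => /=.
rewrite FracField.equivfE /FracField.mulf !numden_Ratio ?oner_eq0 //.
  by rewrite !mul1r mulr1 mulrC.
all: by rewrite mul1r denom_ratioP.
Qed.

(* Sets generating a fractional ideal. *)
Definition vbounded (S : set F) : Prop :=
  (exists2 x, S x & x != 0) /\
  (exists2 d : R, d != 0 & forall x, S x -> in_base (d%:F * x)).

Lemma fractional_vbounded I : fractional_ideal I -> vbounded I.
Proof. by case. Qed.

Lemma finv_vbounded S : vbounded S -> vbounded (finv S).
Proof.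
move=> [[x Sx x0] [d d0 dS]]; split.
  by exists d%:F; rewrite ?tofrac_eq0 // => y /dS.
have [b b0 [a ab]] := frac_denom x; exists a.
  by rewrite -(tofrac_eq0 a) -ab mulf_neq0 ?tofrac_eq0.
move=> y Iy; rewrite -ab -mulrA (mulrC x).
by apply: in_baseM; [exact: in_base_tofrac | exact: Iy].
Qed.

Lemma finv_fractional S : vbounded S -> fractional_ideal (finv S).
Proof.
move=> bS; have [ne bd] := finv_vbounded bS; split=> //.
- by move=> y _; exists 0; rewrite mul0r rmorph0.
- move=> x y Ix Iy z Sz; rewrite mulrDl.
  by apply: in_baseD; [exact: Ix | exact: Iy].
- move=> a x Ix z Sz; rewrite -mulrA.
  by apply: in_baseM; [exact: in_base_tofrac | exact: Ix].
Qed.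

Lemma sub_vclosure S : S `<=` vclosure S.
Proof. by move=> x Sx y Iy; rewrite mulrC; exact: Iy. Qed.

Lemma finv_anti S T : S `<=` T -> finv T `<=` finv S.
Proof. by move=> ST x Tx y /ST /Tx. Qed.

Lemma finv_vclosure S : finv (vclosure S) = finv S.
Proof.
apply/seteqP; split; last exact: sub_vclosure.
exact: (finv_anti (@sub_vclosure S)).
Qed.

Lemma vclosure_divisorial S : vbounded S -> divisorial (vclosure S).
Proof.
move=> bS; split; first by apply/finv_fractional/finv_vbounded.
by rewrite /vclosure finv_vclosure.
Qed.

Lemma fprod_vbounded S T : vbounded S -> vbounded T -> vbounded (fprod S T).
Proof.
move=> [[x Sx x0] [d d0 dS]] [[y Ty y0] [e e0 eT]]; split.
  by exists (x * y); [exists x => //; exists y | rewrite mulf_neq0].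
exists (d * e); first by rewrite mulf_neq0.
move=> _ [u Su [v Tv <-]]; rewrite rmorphM mulrACA.
by apply: in_baseM; [exact: dS | exact: eT].
Qed.

Lemma fprodC S T : fprod S T = fprod T S.
Proof.
by apply/seteqP; split=> _ [x Sx [y Ty <-]]; exists y => //; exists x => //;
  rewrite mulrC.
Qed.

Lemma fprodA S T U : fprod S (fprod T U) = fprod (fprod S T) U.
Proof.
apply/seteqP; split.
  move=> _ [x Sx [_ [y Ty [z Uz <-]] <-]].
  by exists (x * y); [exists x => //; exists y | exists z; rewrite ?mulrA].
move=> _ [_ [x Sx [y Ty <-]] [z Uz <-]].
by exists x => //; exists (y * z); [exists y => //; exists z | rewrite mulrA].
Qed.

Lemma finv_fprod S T x :
  finv (fprod S T) x <-> forall y, S y -> finv T (x * y).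
Proof.
split=> [Ix y Sy z Tz|Ix _ [y Sy [z Tz <-]]]; last by rewrite mulrA; exact: Ix.
by rewrite -mulrA; apply: Ix; exists y => //; exists z.
Qed.

Lemma vclosure_fprodr S T : vclosure (fprod S (vclosure T)) = vclosure (fprod S T).
Proof.
rewrite /vclosure; congr finv; apply/seteqP.
by split=> x /finv_fprod Ix; apply/finv_fprod => y /Ix; rewrite finv_vclosure.
Qed.

Lemma vclosure_fprodl S T : vclosure (fprod (vclosure S) T) = vclosure (fprod S T).
Proof. by rewrite fprodC vclosure_fprodr fprodC. Qed.

Lemma finv_fscale c S : c != 0 -> finv (fscale c S) = fscale c^-1 (finv S).
Proof.
move=> c0; apply/seteqP; split=> [x Ix|_ [x Ix <-] _ [y Sy <-]].
  exists (c * x); last by rewrite mulKf.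
  by move=> y Sy; rewrite -mulrA mulrCA; apply: Ix; exists y.
by rewrite mulrACA mulVf // mul1r; exact: Ix.
Qed.

Lemma vclosure_fscale c S : c != 0 -> vclosure (fscale c S) = fscale c (vclosure S).
Proof. by move=> c0; rewrite /vclosure !finv_fscale ?invr_neq0 // invrK. Qed.

Lemma fprod_fscale c e S T :
  fprod (fscale c S) (fscale e T) = fscale (c * e) (fprod S T).
Proof.
apply/seteqP; split.
  move=> _ [_ [x Sx <-] [_ [y Ty <-] <-]].
  by exists (x * y); [exists x => //; exists y | rewrite mulrACA].
move=> _ [_ [x Sx [y Ty <-]] <-].
by exists (c * x); [exists x | exists (e * y); [exists y | rewrite mulrACA]].
Qed.

Lemma fscaleA c e S : fscale c (fscale e S) = fscale (c * e) S.
Proof.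
apply/seteqP; split=> [_ [_ [x Sx <-] <-]|_ [x Sx <-]].
  by exists x => //; rewrite mulrA.
by exists (e * x); [exists x | rewrite mulrA].
Qed.

Lemma fscale1 S : fscale 1 S = S.
Proof.
apply/seteqP; split=> [_ [x Sx <-]|x Sx]; first by rewrite mul1r.
by exists x; rewrite ?mul1r.
Qed.

Lemma in_base_vbounded : vbounded in_base.
Proof.
split; exists 1; rewrite ?oner_eq0 //; first by exists 1; rewrite rmorph1.
by move=> x; rewrite rmorph1 mul1r.
Qed.

Lemma vclosure_in_base : vclosure in_base = in_base.
Proof.
have finvR : finv in_base = in_base.
  apply/seteqP; split=> [x Ix|x [a ->] y Ry]; last first.
    by apply: in_baseM => //; exact: in_base_tofrac.
  by have := Ix 1 (ex_intro _ 1 (esym (rmorph1 _))); rewrite mulr1.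
by rewrite /vclosure !finvR.
Qed.

Lemma in_base_divisorial : divisorial in_base.
Proof.
by rewrite -vclosure_in_base; apply: vclosure_divisorial; exact: in_base_vbounded.
Qed.

Lemma fprod_in_base I : fractional_ideal I -> fprod in_base I = I.
Proof.
move=> [_ _ IZ _ _]; apply/seteqP; split=> [_ [_ [a ->] [y Iy <-]]|x Ix].
  exact: IZ.
by exists 1; [exists 1; rewrite rmorph1 | exists x; rewrite ?mul1r].
Qed.

End DivisorialIdeals.

(* The divisor class group: divisorial fractional ideals modulo nonzero
   principal ones, under the divisorial product.  Over an arbitrary domain the
   divisorial ideals only form a commutative monoid (a group if and only if the
   domain is completely integrally closed, as normal Noetherian domains are), so
   the type below is an nmodType; on a normal Noetherian domain it is the
   divisor class group, written additively. *)

Section ClassGroup.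
Variable R : idomainType.
Local Notation F := {fraction R}.

Record divisor := Divisor { ideal_of : set F; ideal_ofP : divisorial ideal_of }.

HB.instance Definition _ := gen_eqMixin divisor.
HB.instance Definition _ := gen_choiceMixin divisor.

Lemma divisor_inj : injective ideal_of.
Proof.
by move=> [I dI] [J dJ] /= eIJ; move: dI; rewrite eIJ => dI; congr Divisor;
  exact: Prop_irrelevance.
Qed.

Lemma ideal_of_vbounded (I : divisor) : vbounded (ideal_of I).
Proof. exact: fractional_vbounded (proj1 (ideal_ofP I)). Qed.

Definition divisor_closure (S : set F) (bS : vbounded S) : divisor :=
  Divisor (vclosure_divisorial bS).

Definition divisor_one : divisor := Divisor (in_base_divisorial R).

Definition divisor_mul (I J : divisor) : divisor :=
  divisor_closure (fprod_vbounded (ideal_of_vbounded I) (ideal_of_vbounded J)).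

Definition lin_equiv (I J : divisor) : bool :=
  `[< exists2 c : F, c != 0 & ideal_of I = fscale c (ideal_of J) >].

Lemma lin_equiv_refl : reflexive lin_equiv.
Proof. by move=> I; apply/asboolP; exists 1; rewrite ?oner_eq0 // fscale1. Qed.

Lemma lin_equiv_impl I J : lin_equiv I J -> lin_equiv J I.
Proof.
move=> /asboolP e1; apply/asboolP; have [c c0 e] := e1.
exists c^-1; rewrite ?invr_neq0 //.
by rewrite e fscaleA mulVf // fscale1.
Qed.

Lemma lin_equiv_sym : symmetric lin_equiv.
Proof. by move=> I J; apply/idP/idP; exact: lin_equiv_impl. Qed.

Lemma lin_equiv_trans : transitive lin_equiv.
Proof.
move=> J I K /asboolP e1 /asboolP e2; apply/asboolP.
have [c c0 e] := e1; have [c' c0' e'] := e2.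
by exists (c * c'); rewrite ?mulf_neq0 // e e' fscaleA.
Qed.

Canonical lin_equiv_equiv :=
  EquivRel lin_equiv lin_equiv_refl lin_equiv_sym lin_equiv_trans.

Definition class_group := {eq_quot lin_equiv}.

HB.instance Definition _ : EqQuotient _ lin_equiv class_group :=
  EqQuotient.on class_group.
HB.instance Definition _ := Choice.on class_group.

Definition divisor_class (I : divisor) : class_group := \pi I.

Lemma divisor_classP I J :
  reflect (exists2 c : F, c != 0 & ideal_of I = fscale c (ideal_of J))
          (divisor_class I == divisor_class J).
Proof. by rewrite eqmodE; exact: asboolP. Qed.

Definition class_zero : class_group := divisor_class divisor_one.

Definition class_add (x y : class_group) : class_group :=
  divisor_class (divisor_mul (repr x) (repr y)).

Lemma divisor_classM I J :
  divisor_class (divisor_mul I J) =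
  class_add (divisor_class I) (divisor_class J).
Proof.
have repr_class D : exists2 c : F, c != 0 &
    ideal_of D = fscale c (ideal_of (repr (divisor_class D))).
  by apply/divisor_classP; rewrite /divisor_class reprK.
have [c c0 eI] := repr_class I; have [e e0 eJ] := repr_class J.
apply/eqP/divisor_classP; exists (c * e); first by rewrite mulf_neq0.
by rewrite /= {1}eI {1}eJ fprod_fscale vclosure_fscale ?mulf_neq0.
Qed.

Lemma class_addC : commutative class_add.
Proof.
elim/quotW=> I; elim/quotW=> J.
rewrite -[\pi I]/(divisor_class I) -[\pi J]/(divisor_class J) -!divisor_classM.
by congr divisor_class; apply: divisor_inj; rewrite /= fprodC.
Qed.

Lemma class_addA : associative class_add.
Proof.
elim/quotW=> I; elim/quotW=> J; elim/quotW=> K.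
rewrite -[\pi I]/(divisor_class I) -[\pi J]/(divisor_class J).
rewrite -[\pi K]/(divisor_class K) -!divisor_classM.
congr divisor_class; apply: divisor_inj.
by rewrite /= vclosure_fprodr vclosure_fprodl fprodA.
Qed.

Lemma class_add0 : left_id class_zero class_add.
Proof.
elim/quotW=> I; rewrite -[\pi I]/(divisor_class I) -divisor_classM.
congr divisor_class; apply: divisor_inj => /=.
by have [fI vI] := ideal_ofP I; rewrite fprod_in_base.
Qed.

HB.instance Definition _ :=
  GRing.isNmodule.Build class_group class_addA class_addC class_add0.

Definition extension (I : set R) : set F := [set a%:F | a in I].

Lemma extension_vbounded I : (exists2 a, I a & a != 0) -> vbounded (extension I).
Proof.
move=> [a Ia a0]; split; first by exists a%:F; [exists a | rewrite tofrac_eq0].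
exists 1; rewrite ?oner_eq0 // => _ [b _ <-].
by rewrite rmorph1 mul1r; exact: in_base_tofrac.
Qed.

(* The class of the divisorial ideal generated by an ideal of R. *)
Definition ideal_class (I : set R) (I0 : exists2 a, I a & a != 0) : class_group :=
  divisor_class (divisor_closure (extension_vbounded I0)).

End ClassGroup.

(* G / Z w.  The relation x + a w = y + b w (a, b : nat) is a congruence on any
   commutative monoid; on a group it says that x - y is a multiple of w. *)

Section CyclicQuotient.
Variables (G : nmodType) (w : G).

Definition cyclic_equiv (x y : G) : bool :=
  `[< exists a b : nat, x + w *+ a = y + w *+ b >].

Lemma cyclic_equiv_refl : reflexive cyclic_equiv.
Proof. by move=> x; apply/asboolP; exists 0%N, 0%N. Qed.

Lemma cyclic_equiv_sym : symmetric cyclic_equiv.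
Proof. by move=> x y; apply/asboolP/asboolP => -[a [b e]]; exists b, a. Qed.

Lemma cyclic_equiv_trans : transitive cyclic_equiv.
Proof.
move=> y x z /asboolP e1 /asboolP e2; apply/asboolP.
have [a [b e]] := e1; have [a' [b' e']] := e2.
exists (a + a')%N, (b' + b)%N.
by rewrite !mulrnDr !addrA e addrAC e'.
Qed.

Canonical cyclic_equiv_equiv :=
  EquivRel cyclic_equiv cyclic_equiv_refl cyclic_equiv_sym cyclic_equiv_trans.

Definition cyclic_quotient := {eq_quot cyclic_equiv}.

HB.instance Definition _ : EqQuotient _ cyclic_equiv cyclic_quotient :=
  EqQuotient.on cyclic_quotient.
HB.instance Definition _ := Choice.on cyclic_quotient.

Definition cyclic_pi (x : G) : cyclic_quotient := \pi x.

Lemma cyclic_piP x y :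
  reflect (exists a b : nat, x + w *+ a = y + w *+ b)
          (cyclic_pi x == cyclic_pi y).
Proof. by rewrite eqmodE; exact: asboolP. Qed.

Definition cyclic_add (x y : cyclic_quotient) : cyclic_quotient :=
  cyclic_pi (repr x + repr y).

Lemma cyclic_piD x y : cyclic_pi (x + y) = cyclic_add (cyclic_pi x) (cyclic_pi y).
Proof.
have repr_pi u : exists a b : nat, u + w *+ a = repr (cyclic_pi u) + w *+ b.
  by apply/cyclic_piP; rewrite /cyclic_pi reprK.
have [a [b e]] := repr_pi x; have [a' [b' e']] := repr_pi y.
apply/eqP/cyclic_piP; exists (a + a')%N, (b + b')%N.
by rewrite !mulrnDr addrACA e e' addrACA.
Qed.

Lemma cyclic_addC : commutative cyclic_add.
Proof. by move=> x y; rewrite /cyclic_add addrC. Qed.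

Lemma cyclic_addA : associative cyclic_add.
Proof.
elim/quotW=> x; elim/quotW=> y; elim/quotW=> z.
rewrite -[\pi x]/(cyclic_pi x) -[\pi y]/(cyclic_pi y) -[\pi z]/(cyclic_pi z).
by rewrite -!cyclic_piD addrA.
Qed.

Lemma cyclic_add0 : left_id (cyclic_pi 0) cyclic_add.
Proof.
by elim/quotW=> x; rewrite -[\pi x]/(cyclic_pi x) -cyclic_piD add0r.
Qed.

HB.instance Definition _ :=
  GRing.isNmodule.Build cyclic_quotient cyclic_addA cyclic_addC cyclic_add0.

End CyclicQuotient.

(* A has one column per generator and one row per relation.  A surjection from
   Z^n forces G to be a (finitely generated abelian) group. *)
Definition presents (m n : nat) (A : 'M[int]_(m, n)) (G : nmodType) : Prop :=
  exists f : {additive 'rV[int]_n -> G},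
    (forall g, exists u, f u = g) /\
    (forall u v, f u = f v <-> exists c : 'rV[int]_m, u - v = c *m A).

(* Selections f, g of rows and columns with repetitions give zero determinants,
   and reordering only changes signs, so these determinants generate I_k(A);
   the empty determinant gives I_0(A) = Z. *)
Definition minor_ideal (k m n : nat) (A : 'M[int]_(m, n)) : set int :=
  ideal_generated
    [set \det (mxsub f.1 f.2 A) | f in [set: ('I_k -> 'I_m) * ('I_k -> 'I_n)]].

(* By Fitting's lemma I_(n-i)(A) is the same for all presentations of G, so the
   union is that common value; (n - i)%N is 0 when i >= n. *)
Definition fitting_ideal (i : nat) (G : nmodType) : set int :=
  [set z | exists (m n : nat) (A : 'M[int]_(m, n)),
     presents A G /\ minor_ideal (n - i) A z].

Definition is_rank (G : nmodType) (r : nat) : Prop :=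
  (exists f : {additive 'rV[int]_r -> G}, injective f) /\
  (forall s (f : {additive 'rV[int]_s -> G}), injective f -> (s <= r)%N).

Definition rank (G : nmodType) : nat := xget 0%N [set r | is_rank G r].

(* d(R), for G = Cl(R) and w the class of the canonical module *)
Definition torsion_number (G : nmodType) (w : G) : nat :=
  let Gbar := cyclic_quotient w in
  let r := rank Gbar in
  if pselect (fitting_ideal r G = fitting_ideal r Gbar) then 0%N
  else xget 0%N
    [set d : nat | fitting_ideal r Gbar = [set d%:Z * z | z in [set: int]]].

Section JoinMeetCone.
Variables (disp : Order.disp_t) (P : finPOrderType disp).

Inductive hat := Bot | Elt of P | Top.

Definition hat_code (x : hat) : option (option P) :=
  match x with Bot => None | Elt p => Some (Some p) | Top => Some None end.
Definition hat_decode (x : option (option P)) : hat :=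
  match x with None => Bot | Some (Some p) => Elt p | Some None => Top end.
Lemma hat_codeK : cancel hat_code hat_decode. Proof. by case. Qed.

HB.instance Definition _ := Finite.copy hat (can_type hat_codeK).

Definition hat_lt (x y : hat) : bool :=
  match x, y with
  | Bot, Bot => false
  | Bot, _ => true
  | Elt p, Elt q => (p < q)%O
  | Elt _, Top => true
  | _, _ => false
  end.

Definition hasse (x y : hat) : bool :=
  hat_lt x y && [forall z, ~~ (hat_lt x z && hat_lt z y)].

(* The coordinate z_0 is indexed by None and the coordinate z_i by Some p_i. *)
Definition hat_coord (V : zmodType) (z : {ffun option P -> V}) (x : hat) : V :=
  match x with Bot => z None | Elt p => z (Some p) | Top => 0 end.

(* f_e(z) for the edge e = (x, y) *)
Definition edge_form (V : zmodType) (x y : hat) (z : {ffun option P -> V}) : V :=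
  hat_coord z x - hat_coord z y.

Definition in_cone (V : numDomainType) (z : {ffun option P -> V}) : bool :=
  [forall x, forall y, hasse x y ==> (0 <= edge_form x y z)].

(* relint_coneP below shows that this is the relative interior. *)
Definition in_interior (V : numDomainType) (z : {ffun option P -> V}) : bool :=
  [forall x, forall y, hasse x y ==> (0 < edge_form x y z)].

Lemma in_coneP (V : numDomainType) (z : {ffun option P -> V}) :
  reflect (forall x y, hasse x y -> 0 <= edge_form x y z) (in_cone z).
Proof.
apply: (iffP forallP) => [h x y|h x]; last by apply/forallP=> y; apply/implyP/h.
by have /forallP/(_ y)/implyP := h x.
Qed.

Lemma in_interiorP (V : numDomainType) (z : {ffun option P -> V}) :
  reflect (forall x y, hasse x y -> 0 < edge_form x y z) (in_interior z).
Proof.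
apply: (iffP forallP) => [h x y|h x]; last by apply/forallP=> y; apply/implyP/h.
by have /forallP/(_ y)/implyP := h x.
Qed.

Lemma edge_formD (V : zmodType) x y (u v : {ffun option P -> V}) :
  edge_form x y (u + v) = edge_form x y u + edge_form x y v.
Proof.
have coordD t : hat_coord (u + v) t = hat_coord u t + hat_coord v t.
  by case: t => [|p|] /=; rewrite ?ffunE ?addr0.
by rewrite /edge_form !coordD opprD addrACA.
Qed.

Lemma edge_formN (V : zmodType) x y (u : {ffun option P -> V}) :
  edge_form x y (- u) = - edge_form x y u.
Proof.
have coordN t : hat_coord (- u) t = - hat_coord u t.
  by case: t => [|p|] /=; rewrite ?ffunE ?oppr0.
by rewrite /edge_form !coordN opprD.
Qed.

Lemma hat_lt_irr x : hat_lt x x = false.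
Proof. by case: x => //= p; rewrite ltxx. Qed.

Lemma hat_lt_trans y x z : hat_lt x y -> hat_lt y z -> hat_lt x z.
Proof. by case: x => [|p|]; case: y => [|q|]; case: z => [|r|] //=; apply: lt_trans. Qed.

Definition up (x : hat) : nat := #|[pred y | hat_lt x y]|.

Lemma up_lt x y : hat_lt x y -> (up y < up x)%N.
Proof.
move=> xy; apply: proper_card; apply/properP; split.
  by apply/fintype.subsetP=> z; rewrite !inE; exact: hat_lt_trans.
by exists y; rewrite !inE ?hat_lt_irr.
Qed.

Lemma hasse_exists x : x <> Top -> exists y, hasse x y.
Proof.
move=> xT; have xT' : hat_lt x Top by case: x xT.
case: (arg_maxnP up xT') => y /= xy ymax; exists y.
rewrite /hasse xy; apply/forallP=> z; apply/negP=> /andP[xz zy].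
by have := ymax z xz; rewrite /= leqNgt up_lt.
Qed.

Lemma hat_coord_ge0 (V : numDomainType) (z : {ffun option P -> V}) x :
  in_cone z -> 0 <= hat_coord z x.
Proof.
move=> /in_coneP Cz; have [n] := ubnP (up x); elim: n x => // n IHn x xn.
have [->//|/hasse_exists[y xy]] := pselect (x = Top).
have := Cz x y xy; rewrite subr_ge0; apply: le_trans; apply: IHn.
by apply: leq_trans (up_lt (proj1 (andP xy))) _; rewrite -ltnS.
Qed.

Lemma in_cone_ge0 (V : numDomainType) (z : {ffun option P -> V}) i :
  in_cone z -> 0 <= z i.
Proof.
by case: i => [p|]; [exact: (@hat_coord_ge0 _ _ (Elt p)) | exact: (@hat_coord_ge0 _ _ Bot)].
Qed.

Lemma in_cone0 (V : numDomainType) : in_cone (0 : {ffun option P -> V}).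
Proof.
apply/in_coneP=> x y _.
by case: x => [|p|]; case: y => [|q|]; rewrite /edge_form /= ?ffunE subr0.
Qed.

Lemma in_coneD (V : numDomainType) (u v : {ffun option P -> V}) :
  in_cone u -> in_cone v -> in_cone (u + v).
Proof.
move=> /in_coneP Cu /in_coneP Cv; apply/in_coneP=> x y xy.
by rewrite edge_formD addr_ge0 ?Cu ?Cv.
Qed.

Definition up_point (V : numDomainType) : {ffun option P -> V} :=
  [ffun i => (up (if i is Some p then Elt p else Bot))%:R].

Lemma up_point_interior (V : numDomainType) : in_interior (up_point V).
Proof.
have upE x : hat_coord (up_point V) x = (up x)%:R.
  case: x => [|p|] /=; rewrite ?ffunE //; apply/esym/eqP.
  by rewrite pnatr_eq0; apply/eqP/eq_card0; case.
by apply/in_interiorP=> x y /andP[xy _]; rewrite subr_gt0 !upE ltr_nat up_lt.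
Qed.

Lemma in_interior_cone (V : numDomainType) (z : {ffun option P -> V}) :
  in_interior z -> in_cone z.
Proof. by move=> /in_interiorP Cz; apply/in_coneP=> x y /Cz/ltW. Qed.

Lemma relint_coneP (V : realFieldType) (z : {ffun option P -> V}) :
  in_interior z <->
  in_cone z /\ exists2 e : V, 0 < e &
    forall y, (exists u v, [/\ in_cone u, in_cone v & y = u - v]) ->
      (forall i, `|y i - z i| < e) -> in_cone y.
Proof.
split=> [Iz|[Cz [e e0 near]]].
  split; first exact: in_interior_cone.
  pose e := \big[Order.min/1]_(xy : hat * hat | hasse xy.1 xy.2)
              (edge_form xy.1 xy.2 z / 2%:R).
  exists e.
    rewrite /e; elim/big_ind: _ => // [a b a0 b0|xy hxy].
      by rewrite lt_min a0.
    by rewrite divr_gt0 ?ltr0n // (in_interiorP _ Iz).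
  move=> y _ yz; apply/in_coneP=> a b ab.
  have e0 : 0 < e by apply: le_lt_trans (yz None).
  have le_e : e <= edge_form a b z / 2%:R.
    by rewrite /e (bigD1 (a, b)) //= ge_min lexx.
  have coordz x : `|hat_coord y x - hat_coord z x| < e.
    by case: x => [|p|] //=; rewrite subrr normr0.
  have := coordz a; have := coordz b; rewrite !ltr_distl => /andP[_ hb] /andP[ha _].
  rewrite subr_ge0; apply: le_trans (ltW hb) _; apply: le_trans _ (ltW ha).
  rewrite lerBrDr -addrA -lerBrDl -/(edge_form a b z).
  apply: le_trans (lerD le_e le_e) _.
  by rewrite -splitr.
apply/in_interiorP=> a b ab; rewrite lt_neqAle (in_coneP _ Cz) // andbT.
apply/negP=> /eqP fz0.
have [w Iw] : exists w : {ffun option P -> V}, in_interior w.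
  by exists (up_point V); exact: up_point_interior.
pose s := \sum_i `|w i| + 1.
have s0 : 0 < s by rewrite ltr_wpDl ?sumr_ge0.
pose t := e / s; have t0 : 0 < t by rewrite divr_gt0.
pose tw : {ffun option P -> V} := [ffun i => t * w i].
have twE x : hat_coord tw x = t * hat_coord (w) x.
  by case: x => [|p|] /=; rewrite ?ffunE ?mulr0.
have ftw x y : edge_form x y tw = t * edge_form x y (w).
  by rewrite /edge_form !twE mulrBr.
have Itw : in_interior tw.
  by apply/in_interiorP=> x y xy; rewrite ftw mulr_gt0 ?(in_interiorP _ Iw).
suff /in_coneP/(_ a b ab) : in_cone (z - tw).
  rewrite edge_formD edge_formN -fz0 add0r oppr_ge0 leNgt.
  by rewrite (in_interiorP _ Itw).
apply: near; first by exists z, tw; split=> //; exact: in_interior_cone.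
move=> i; rewrite !ffunE addrAC subrr add0r normrN normrM gtr0_norm //.
rewrite /t mulrAC ltr_pdivrMr // ltr_pM2l // /s ltr_pwDr //.
by rewrite (bigD1 i) //= lerDl sumr_ge0.
Qed.

(* C cap Z^(n+1), as a multiplicatively written monoid of monomials *)
Record cone_point :=
  ConePoint { exponent :> {ffun option P -> int}; _ : in_cone exponent }.

HB.instance Definition _ := [isSub for exponent].
HB.instance Definition _ := [Choice of cone_point by <:].

Lemma exponent_cone (a : cone_point) : in_cone (exponent a).
Proof. by case: a. Qed.

Definition cone_one : cone_point := ConePoint (in_cone0 _).
Definition cone_mul (a b : cone_point) : cone_point :=
  ConePoint (in_coneD (exponent_cone a) (exponent_cone b)).

Lemma cone_mulA : associative cone_mul.
Proof. by move=> a b c; apply: val_inj; rewrite /= addrA. Qed.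
Lemma cone_mulC : commutative cone_mul.
Proof. by move=> a b; apply: val_inj; rewrite /= addrC. Qed.
Lemma cone_mul1 : left_id cone_one cone_mul.
Proof. by move=> a; apply: val_inj; rewrite /= add0r. Qed.
Lemma cone_1mul : right_id cone_one cone_mul.
Proof. by move=> a; rewrite cone_mulC cone_mul1. Qed.
Lemma cone_unit a b : cone_mul a b = cone_one -> a = cone_one /\ b = cone_one.
Proof.
move=> /(congr1 exponent)/ffunP e.
have ab0 i : (exponent a i = 0) * (exponent b i = 0).
  have := e i; rewrite /= !ffunE => /eqP.
  by rewrite paddr_eq0 ?in_cone_ge0 ?exponent_cone // => /andP[/eqP-> /eqP->].
by split; apply: val_inj; apply/ffunP=> i; rewrite /= ab0 ffunE.
Qed.

HB.instance Definition _ :=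
  Choice_isMonomialDef.Build cone_point cone_mulA cone_mul1 cone_1mul cone_unit.
HB.instance Definition _ := MonomialDef_isConomialDef.Build cone_point cone_mulC.

End JoinMeetCone.

Section JoinMeetRing.
Import mpoly monalg.
Variables (K : fieldType) (disp : Order.disp_t) (P : finPOrderType disp).

Definition join_meet_ring := {malg K[cone_point P]}.

HB.instance Definition _ := GRing.ComAlgebra.on join_meet_ring.

(* Exponent vectors in C are nonnegative, so the ring embeds into a polynomial
   ring; this serves only to show that it is a domain. *)
Local Notation nvars := #|{: option P}|.
Local Notation poly := (mpoly.mpoly nvars K).

Definition mpoly_exponent (a : cone_point P) : mpoly.multinom nvars :=
  mpoly.Multinom [tuple `|exponent a (enum_val i)|%N | i < nvars].

Lemma mpoly_exponentE a i :
  mpoly.fun_of_multinom (mpoly_exponent a) i = `|exponent a (enum_val i)|%N.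
Proof. by rewrite mpoly.multinomE tnth_mktuple. Qed.

Lemma mpoly_exponent_inj : injective mpoly_exponent.
Proof.
move=> a b /mpoly.mnmP e; apply: val_inj; apply/ffunP=> i.
have := e (enum_rank i); rewrite !mpoly_exponentE enum_rankK => /(congr1 Posz).
by rewrite !gez0_abs ?in_cone_ge0 ?exponent_cone.
Qed.

Definition mpoly_monomial (a : cone_point P) : poly :=
  mpoly.mpolyX K (mpoly_exponent a).

Lemma mpoly_monomial_mmorphism : mmorphism mpoly_monomial.
Proof.
split=> [a b|]; rewrite /mpoly_monomial.
  rewrite -mpoly.mpolyXD; congr mpoly.mpolyX; apply/mpoly.mnmP=> i.
  rewrite mpoly.mnmDE !mpoly_exponentE; apply/eqP; rewrite -eqz_nat PoszD.
  by rewrite !gez0_abs ?in_cone_ge0 ?exponent_cone //= ffunE.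
rewrite -mpoly.mpolyX0; congr mpoly.mpolyX; apply/mpoly.mnmP=> i.
by rewrite mpoly.mnm0E mpoly_exponentE /= ffunE.
Qed.

HB.instance Definition _ :=
  isMultiplicative.Build _ _ mpoly_monomial mpoly_monomial_mmorphism.

Definition to_mpoly : join_meet_ring -> poly :=
  mmap (@mpoly.mpolyC nvars K) mpoly_monomial.

Lemma to_mpolyM g h : to_mpoly (g * h) = to_mpoly g * to_mpoly h.
Proof. exact: (rmorphM (mmap (@mpoly.mpolyC nvars K) mpoly_monomial)). Qed.

Lemma to_mpoly_eq0 g : to_mpoly g = 0 -> g = 0.
Proof.
move=> g0; apply/malgP=> a; rewrite mcoeff0.
have := congr1 (mpoly.mcoeff (mpoly_exponent a)) g0.
rewrite mpoly.mcoeff0 /to_mpoly mmapE raddf_sum /= => <-.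
under eq_bigr => b _ do
  rewrite mpoly.mcoeffCM mpoly.mcoeffX (inj_eq mpoly_exponent_inj).
rewrite {1}[g]monalgE raddf_sum /=; apply: eq_bigr => b _.
by rewrite mcoeffU mulr_natr.
Qed.

Lemma join_meet_ring_domain (g h : join_meet_ring) :
  g * h = 0 -> (g == 0) || (h == 0).
Proof.
move=> /(congr1 to_mpoly); rewrite to_mpolyM /to_mpoly mmap0 => /eqP.
by rewrite mulf_eq0 => /orP[] /eqP/to_mpoly_eq0 ->; rewrite eqxx ?orbT.
Qed.

Definition jm_unit (g : join_meet_ring) : bool := `[< exists h, h * g = 1 >].

Definition jm_inv (g : join_meet_ring) : join_meet_ring :=
  if pselect (exists h, h * g = 1) is left e then projT1 (cid e) else g.

Lemma jm_mulV : {in jm_unit, left_inverse 1 jm_inv *%R}.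
Proof.
move=> g /asboolP gu; rewrite /jm_inv; case: pselect => // e.
exact: projT2 (cid e).
Qed.

Lemma jm_unitP (g h : join_meet_ring) : h * g = 1 -> jm_unit g.
Proof. by move=> hg; apply/asboolP; exists h. Qed.

Lemma jm_inv_out : {in [predC jm_unit], jm_inv =1 id}.
Proof.
by move=> g /asboolPn gu; rewrite /jm_inv; case: pselect.
Qed.

HB.instance Definition _ := GRing.ComNzRing_hasMulInverse.Build join_meet_ring
  jm_mulV jm_unitP jm_inv_out.
HB.instance Definition _ :=
  GRing.ComUnitRing_isIntegral.Build join_meet_ring join_meet_ring_domain.

Definition monomial (a : cone_point P) : join_meet_ring := << a >>.

Definition canonical_ideal : set join_meet_ring :=
  ideal_generated [set monomial a | a in [set a | in_interior (exponent a)]].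

Definition graded_maximal_ideal : set join_meet_ring :=
  ideal_generated [set monomial a | a in [set a | 0 < exponent a None]].

Lemma canonical_ideal_neq0 : exists2 g, canonical_ideal g & g != 0.
Proof.
have Iw := up_point_interior P int.
pose w := ConePoint (in_interior_cone Iw).
exists (monomial w); last by rewrite /monomial monalgU_eq0 oner_eq0.
exists 1%N, (fun=> 1), (fun=> monomial w); split; first by move=> _; exists w.
by rewrite big_ord1 mul1r.
Qed.

(* [omega_R] *)
Definition canonical_class : class_group join_meet_ring :=
  ideal_class canonical_ideal_neq0.

Definition nearly_gorenstein : Prop :=
  graded_maximal_ideal `<=` trace_ideal canonical_ideal.

(* R is a Cohen-Macaulay domain with canonical module omega_R; Gorenstein means
   that the canonical module is isomorphic to R (up to a shift of the grading,
   which module isomorphisms ignore). *)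
Definition gorenstein : Prop := isomorphic_to_ring canonical_ideal.

End JoinMeetRing.

(* Main.v *)
From HB Require Import structures.
From mathcomp Require Import all_boot all_order all_algebra.
From mathcomp Require Import fraction generic_quotient finmap.
From mathcomp Require Import boolp classical_sets.
From mathcomp Require mpoly monalg.
Require Import Defs.

Set Implicit Arguments.
Unset Strict Implicit.
Unset Printing Implicit Defensive.

Import Order.TTheory GRing.Theory Num.Theory.

Local Open Scope classical_set_scope.
Local Open Scope ring_scope.

(** Write [e = (x, y)] for an edge of the Hasse diagram of [hat P] and [f_e(z)]
for the value of its linear form at a lattice point [z].

The class group.  Every divisorial ideal is, up to a principal factor, the ideal
of the Laurent polynomials whose [e]-valuation is at least some integer [b_e] for
each edge [e] ([class_cone]): divide the ideal by a gcd of its elements in the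
Laurent polynomial ring, which is a localization of a polynomial ring and hence
has gcds ([mpoly_has_gcds], [laurent_gcd]), and take for [b_e] the least
[e]-valuation that occurs.  Two families [b] and [d] give the same class exactly
when they differ by [e |-> f_e(z)] for a lattice point [z] ([cone_class_eq]),
because the units of the Laurent polynomial ring are monomials up to scalars.  A
spanning tree of the Hasse diagram then shows that the class group is free, with
one generator for each edge outside the tree ([off_tree_class_inj],
[off_tree_class_surj]).  The canonical class is the class of the constant family
[1] ([canonical_classE]).

The torsion number.  If [w] is a primitive vector of a free group of rank [r + 1],
then the quotient by [w] is free of rank [r]; the Fitting ideal of index [r] is
zero for the group and the unit ideal for the quotient, so the torsion number is
[1] ([torsion_number_primitive]).  It remains to see that the canonical class is
primitive.

Primitivity.  A monomial of the trace ideal has an exponent [z + z'] with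
[f_e(z) >= -1] and [f_e(z') >= 1] on all edges ([trace_monomial]).  If the ring is
nearly Gorenstein, this applies to the exponent that is [1] at the bottom and [0]
on [P]; the corresponding [z'] satisfies [f_e(z') = 1] for every edge [e] that does
not start at the bottom, and [f_e(z')] is [1] or [2] for the others
([nearly_gorenstein_point]).  In terms of the poset, the lengths of the maximal
chains take at most two values, which are consecutive.  If only one of the values
[1] and [2] occurred, then [z'], or [z'] lowered by [1] at the bottom, would have
[f_e = 1] on all edges and would generate the canonical ideal, so the ring would be
Gorenstein ([unimodular_gorenstein]).  Hence both values occur.  Now if the
canonical class is [k] times a class, some lattice point [y] has [f_e(y)] congruent
to [1] modulo [k] on all edges.  Going down from the top, [y] and [z'] are congruent
modulo [k] on [P]; comparing them at the bottom along an edge with [f_e(z') = 1] and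
along one with [f_e(z') = 2] gives that [k] divides [1]
([canonical_class_primitive]). *)

(** * Greatest common divisors of arbitrary sets *)

Definition divides (A : comNzRingType) (d x : A) : Prop := exists q, x = q * d.

(** The divisors of [g] are the common divisors of [S]; in particular [0] is a gcd
of a set without nonzero elements. *)
Definition is_gcd (A : comNzRingType) (S : set A) (g : A) : Prop :=
  forall d, (forall s, S s -> divides d s) <-> divides d g.

(** Infinite sets are included because divisorial ideals are not assumed to be
finitely generated. *)
Definition has_gcds (A : comNzRingType) : Prop :=
  forall S : set A, exists g, is_gcd S g.

Section Divides.
Variable A : comNzRingType.
Implicit Types (a d x y : A) (S : set A).

Lemma divides_refl x : divides x x.
Proof. by exists 1; rewrite mul1r. Qed.

Lemma divides0 d : divides d 0.
Proof. by exists 0; rewrite mul0r. Qed.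

Lemma divides_trans y x z : divides x y -> divides y z -> divides x z.
Proof. by move=> [q ->] [r ->]; exists (r * q); rewrite mulrA. Qed.

Lemma dividesMl d x y : divides d y -> divides d (x * y).
Proof. by move=> [q ->]; exists (x * q); rewrite mulrA. Qed.

Lemma dividesMr d x y : divides d x -> divides d (x * y).
Proof. by rewrite mulrC; exact: dividesMl. Qed.

Lemma dividesD d x y : divides d x -> divides d y -> divides d (x + y).
Proof. by move=> [q ->] [r ->]; exists (q + r); rewrite mulrDl. Qed.

Lemma dividesB d x y : divides d x -> divides d y -> divides d (x - y).
Proof. by move=> [q ->] [r ->]; exists (q - r); rewrite mulrBl. Qed.

Lemma gcd_dvd S g s : is_gcd S g -> S s -> divides g s.
Proof. by move=> gS; apply: (proj2 (gS g)); exact: divides_refl. Qed.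

End Divides.

Lemma rmorph_divides (A B : comNzRingType) (f : {rmorphism A -> B}) d x :
  divides d x -> divides (f d) (f x).
Proof. by move=> [q ->]; exists (f q); rewrite rmorphM. Qed.

Lemma has_gcds_can (A B : comNzRingType) (f : {rmorphism A -> B})
    (g : {rmorphism B -> A}) :
  cancel f g -> cancel g f -> has_gcds B -> has_gcds A.
Proof.
move=> fK gK gcdB S; have [c cS] := gcdB (f @` S); exists (g c) => d.
have dfE x : divides d x <-> divides (f d) (f x).
  by split=> [/(rmorph_divides f)//|/(rmorph_divides g)]; rewrite !fK.
rewrite dfE gK -(cS (f d)); split=> [dS _ [s Ss <-]|dS s Ss]; first exact/dfE/dS.
by apply/dfE/dS; exists s.
Qed.

Lemma field_has_gcds (K : fieldType) : has_gcds K.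
Proof.
move=> S; have [[s Ss s0]|S0] := pselect (exists2 s, S s & s != 0).
  exists 1 => d; split=> [/(_ s Ss) ds|[q e] t _].
    by apply: divides_trans ds _; exists s^-1; rewrite mulVf.
  by exists (t * q); rewrite -mulrA -e mulr1.
exists 0 => d; split=> [_|_ s Ss]; first exact: divides0.
have [->|s0] := eqVneq s 0; first exact: divides0.
by case: S0; exists s.
Qed.

Section Gauss.
Variable A : idomainType.
Hypothesis gcdA : has_gcds A.
Implicit Types (a b c d : A) (p q f : {poly A}).

Lemma divides_mull a d x : a != 0 -> divides (a * d) (a * x) -> divides d x.
Proof.
by move=> a0 [q e]; exists q; apply: (mulfI a0); rewrite e mulrCA.
Qed.

(** A gcd [h] of [a S] is a multiple of [a], say [k * a], and then [k] is a common
divisor of [S]; so [h] divides [a] times a gcd of [S]. *)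
Lemma divides_gcdM (S : set A) g a d :
  is_gcd S g -> (forall s, S s -> divides d (a * s)) -> divides d (a * g).
Proof.
move=> gS daS; have [->|a0] := eqVneq a 0; first by rewrite mul0r; exact: divides0.
have [h hS] := gcdA [set a * s | s in S].
have [k hk] : divides a h.
  by apply/(hS a) => _ [s _ <-]; apply: dividesMr; exact: divides_refl.
apply: divides_trans (_ : divides h _).
  by apply/(hS d) => _ [s Ss <-]; exact: daS.
have [q ->] : divides k g.
  apply/(gS k)=> s Ss; apply: (@divides_mull a) => //.
  by rewrite mulrC -hk; apply: (gcd_dvd hS); exists s.
by exists q; rewrite hk mulrCA [a * k]mulrC.
Qed.

Definition is_content p c := forall d, divides d%:P p <-> divides d c.

Lemma divides_polyC d p : divides d%:P p <-> forall i, divides d p`_i.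
Proof.
split=> [[q ->] i|dp]; first by exists q`_i; rewrite coefMC.
have /choice[q qE] i : exists b, p`_i = b * d by exact: dp.
exists (\poly_(i < size p) q i); apply/polyP=> i.
rewrite coefMC coef_poly; case: ltnP => [_|/(nth_default 0) ->]; first exact: qE.
by rewrite mul0r.
Qed.

Lemma content_exists p : exists c, is_content p c.
Proof.
have [c cp] := gcdA (range (fun i => p`_i)); exists c => d.
rewrite divides_polyC -(cp d); split=> [dp _ [i _ <-] //|dp i].
by apply: dp; exists i.
Qed.

Lemma content_dvd p c : is_content p c -> divides c%:P p.
Proof. by move=> cp; apply/(cp c); exact: divides_refl. Qed.

Lemma divides_contentM p c a d :
  is_content p c -> divides d%:P (a *: p) -> divides d (a * c).
Proof.
move=> cp /divides_polyC dp.
apply: (@divides_gcdM (range (fun i => p`_i))) => [e|_ [i _ <-]].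
  rewrite -(cp e) divides_polyC.
  by split=> [h i|h _ [i _ <-] //]; apply: h; exists i.
by rewrite -coefZ.
Qed.

Lemma content_eq0 p c : is_content p c -> p != 0 -> c != 0.
Proof.
move=> cp; apply: contra_neq => c0; have [q ->] := content_dvd cp.
by rewrite c0 polyC0 mulr0.
Qed.

Lemma primitive_part p c :
  p != 0 -> is_content p c -> exists2 p1, p = c *: p1 & is_content p1 1.
Proof.
move=> p0 cp; have c0 := content_eq0 cp p0.
have [p1 e] := content_dvd cp; exists p1; first by rewrite e mulrC mul_polyC.
move=> d; split=> [dp1|]; last first.
  move=> d1; apply/divides_polyC => i; rewrite -[_`_i]mulr1.
  exact: dividesMl.
apply: (@divides_mull c) => //; rewrite mulr1; apply/(cp (c * d)).
rewrite e polyCM; have [q ->] := dp1.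
by exists q; rewrite -mulrA [d%:P * _]mulrC.
Qed.

(** Gauss's lemma.  The usual argument with a prime factor of [d] is replaced by
an induction on sizes, which needs only gcds: the part that [d] shares with a
leading coefficient divides the product of the truncated polynomial with the
other factor, hence by induction the truncated polynomial, hence it is a unit;
so [d], which divides the product of the two leading coefficients, is a unit. *)
Lemma gauss p q c e d :
  is_content p c -> is_content q e -> divides d%:P (p * q) -> divides d (c * e).
Proof.
have [n] := ubnP (size p + size q)%N.
elim: n => // n IHn in p q c e d * => pqn cp eq dpq.
have [p0|p0] := eqVneq p 0.
  have /(cp 0) c0 : divides (0 : A)%:P p by rewrite p0; exact: divides0.
  by have [r ->] := c0; rewrite mulr0 mul0r; exact: divides0.
have [q0|q0] := eqVneq q 0.
  have /(eq 0) e0 : divides (0 : A)%:P q by rewrite q0; exact: divides0.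
  by have [r ->] := e0; rewrite !mulr0; exact: divides0.
have [p1 pE cp1] := primitive_part p0 cp.
have [q1 qE eq1] := primitive_part q0 eq.
have c0 := content_eq0 cp p0; have e0 := content_eq0 eq q0.
have sp : size p = size p1 by rewrite pE size_scale.
have sq : size q = size q1 by rewrite qE size_scale.
have [p10 q10] : p1 != 0 /\ q1 != 0.
  by rewrite -!size_poly_eq0 -sp -sq !size_poly_eq0.
have common x f g : is_content f 1 -> is_content g 1 -> f != 0 ->
    (size f + size g < n.+1)%N ->
    divides x (lead_coef f) -> divides x%:P (f * g) -> divides x 1.
  move=> cf cg f0 fgn xa xfg; apply/(cf x).
  pose m := (size f).-1; pose f1 := f - lead_coef f *: 'X^m.
  have sf1 : (size f1 < size f)%N.
    rewrite -[X in (_ < X)%N]prednK ?size_poly_gt0 // ltnS.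
    apply/leq_sizeP => j; rewrite leq_eqVlt => /orP[/eqP <-|mj].
      by rewrite coefB coefZ coefXn eqxx mulr1 lead_coefE subrr.
    rewrite coefB coefZ coefXn gtn_eqF // mulr0 subr0 nth_default //.
    by rewrite -(prednK (_ : 0 < size f)%N) ?size_poly_gt0.
  have xX : divides x%:P (lead_coef f *: 'X^m).
    by have [r ->] := xa; exists (r *: 'X^m); rewrite [RHS]mulrC mul_polyC scalerA [x * r]mulrC.
  have [c1 c1f] := content_exists f1.
  have : divides x (c1 * 1).
    apply: (IHn f1 g) => //; first by rewrite -ltnS; apply: leq_trans fgn; rewrite ltnS ltn_add2r.
    by rewrite /f1 mulrBl; apply: dividesB => //; exact: dividesMr.
  rewrite mulr1 => /(c1f x) xf1; rewrite -[f](subrK (lead_coef f *: 'X^m)).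
  exact: dividesD.
have d_pq1 : divides d%:P ((c * e) *: (p1 * q1)).
  by move: dpq; rewrite {1}pE {1}qE -scalerAl -scalerAr scalerA.
have prim_pq : is_content (p1 * q1) 1.
  move=> x; split=> [xpq|x1]; last first.
    apply/divides_polyC => i; rewrite -[_`_i]mulr1; exact: dividesMl.
  have coprime_lead y f g : is_content f 1 -> is_content g 1 -> f != 0 ->
      (size f + size g < n.+1)%N -> divides x%:P (f * g) ->
      divides x (lead_coef f * y) -> divides x y.
    move=> cf cg f0 fgn xfg xay.
    have [h hx] := gcdA [set z | z = x \/ z = lead_coef f].
    have h1 : divides h 1.
      apply: common cf cg f0 fgn _ _; first by apply: (gcd_dvd hx); right.
      apply: divides_trans xfg.
      by apply: (rmorph_divides polyC); apply: (gcd_dvd hx); left.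
    have xyh : divides x (y * h).
      apply: (divides_gcdM hx) => z [->|->]; first exact: dividesMl (divides_refl _).
      by rewrite mulrC.
    apply: divides_trans xyh _; have [u u1] := h1.
    by exists u; rewrite mulrCA -u1 mulr1.
  have xab : divides x (lead_coef p1 * lead_coef q1).
    by rewrite -lead_coefM; exact: (proj1 (divides_polyC _ _) xpq).
  apply: (common x q1 p1) => //; try by rewrite addnC -sp -sq.
    by apply: (coprime_lead _ p1 q1) xab; rewrite // -sp -sq.
  by rewrite mulrC.
by have := divides_contentM prim_pq d_pq1; rewrite mulr1.
Qed.

(** A primitive polynomial loses no divisibility when constants are inverted, which
is what makes pseudo-division by it exact. *)
Lemma divides_primitive p a f :
  a != 0 -> is_content p 1 -> divides p (a *: f) -> divides p f.
Proof.
move=> a0 cp [q afE]; have [e eq] := content_exists q.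
have /(eq a) [q1 qE] : divides a e.
  rewrite -[e]mulr1; apply: gauss eq cp _.
  by exists f; rewrite -afE mulrC mul_polyC.
exists q1; apply: (mulfI (_ : a%:P != 0)); first by rewrite polyC_eq0.
by rewrite mul_polyC afE qE mulrCA mulrA.
Qed.

Lemma content_dvd_primitive d p f c :
  is_content p 1 -> is_content f c -> divides d%:P (p * f) -> divides d%:P f.
Proof.
by move=> pp cf pf; apply/(cf d); rewrite -[c]mul1r; apply: gauss pf.
Qed.

(** Let [T] be the ideal of the polynomials that every common divisor of [S]
divides.  The primitive part [p] of a nonzero element of least size of [T] divides
[S] by pseudo-division, and a gcd of [S] is [p] times a gcd [e] of the coefficients
of the quotients: a common divisor has a content, which divides [e] by Gauss's
lemma, and a primitive part, which divides [p]. *)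
Lemma poly_has_gcds : has_gcds {poly A}.
Proof.
move=> S; pose T t := forall h : {poly A}, (forall s, S s -> divides h s) -> divides h t.
have ST s : S s -> T s by move=> Ss h; exact.
have [[t0 Tt0 t00]|T0] := pselect (exists2 t, T t & t != 0); last first.
  exists 0 => d; split=> [_|_ s Ss]; first exact: divides0.
  have [->|s0] := eqVneq s 0; first exact: divides0.
  by case: T0; exists s => //; exact: ST.
pose sz n := `[< exists2 t, T t & (t != 0) && (size t == n) >].
have [p0 Tp0 /andP[p00 sp0]] : exists2 p, T p &
    (p != 0) && [forall x : 'I_(size p), ~~ sz x].
  have sz0 : exists n, sz n.
    by exists (size t0); apply/asboolP; exists t0; rewrite // t00 eqxx.
  have [n /asboolP[p Tp /andP[p0 /eqP <-]] pmin] := ex_minnP sz0; exists p => //.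
  rewrite p0 /=; apply/forallP => x; apply/negP => /pmin.
  by rewrite leqNgt ltn_ord.
have [c0 cp0] := content_exists p0; have [p p0E cp] := primitive_part p00 cp0.
have c00 := content_eq0 cp0 p00.
have pS s : S s -> divides p s.
  move=> Ss; set a := lead_coef p0 ^+ scalp s p0.
  have a0 : a != 0 by rewrite expf_neq0 ?lead_coef_eq0.
  have sE : a *: s = s %/ p0 * p0 + s %% p0 by exact: Pdiv.Idomain.divp_eq.
  have r0 : s %% p0 = 0.
    apply/eqP/negP => /negP r0.
    have /forallP/(_ (Ordinal (Pdiv.Idomain.ltn_modpN0 s p00)))/asboolP := sp0.
    apply; exists (s %% p0); rewrite ?r0 ?eqxx // => d dS.
    have -> : s %% p0 = a *: s - s %/ p0 * p0 by rewrite sE addrC addKr.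
    apply: dividesB; first by rewrite -mul_polyC; apply/dividesMl/dS.
    by apply/dividesMl/Tp0.
  apply: (@divides_primitive _ a) => //; exists (s %/ p0 * c0%:P).
  by rewrite sE r0 addr0 {2}p0E -mul_polyC mulrA.
have [e eQ] := gcdA [set b | exists q i, S (q * p) /\ b = q`_i].
have eS q : S (q * p) -> forall d, divides d e -> divides d%:P q.
  by move=> Sq d de; apply/divides_polyC => i; apply: (proj2 (eQ d) de); exists q, i.
exists (e *: p) => d; split=> [dS|dep s Ss]; last first.
  apply: divides_trans dep _; have [q sE] := pS s Ss.
  have [r qE] := eS q (eq_ind _ S Ss _ sE) e (divides_refl e).
  by exists r; rewrite sE qE -mul_polyC mulrA.
have [q p0d] := Tp0 d dS.
have d0 : d != 0 by apply: contra_neq p00 => d0; rewrite p0d d0 mulr0.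
have [a ca] := content_exists d; have [d1 dE cd1] := primitive_part d0 ca.
have [u pE] : divides d1 p.
  apply: (@divides_primitive _ c0) => //; rewrite -p0E p0d dE -mul_polyC mulrA.
  exact: dividesMl (divides_refl _).
have cu : is_content u 1.
  move=> x; rewrite -(cp x); split=> [xu|]; first by rewrite pE; exact: dividesMr.
  move=> /(cp x) x1; apply/divides_polyC => i; rewrite -[_`_i]mulr1.
  exact: dividesMl.
have ae : divides a e.
  apply/(eQ a) => _ [f [i [Sfp ->]]]; apply: (proj1 (divides_polyC a f)).
  have [c fc] := content_exists f.
  apply: (content_dvd_primitive cu fc); have [r rE] := dS _ Sfp.
  exists r; have d10 : d1 != 0 by apply: contra_neq d0 => d10; rewrite dE d10 scaler0.
  by apply: (mulIf d10); rewrite mulrAC -pE mulrC rE dE -mul_polyC mulrA.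
have [b ->] := ae; exists (b%:P * u).
by rewrite pE dE -!mul_polyC polyCM !mulrA; congr (_ * _); rewrite mulrAC.
Qed.

End Gauss.

Section MpolyGcd.
Import mpoly.
Variable K : fieldType.

Lemma mpoly_rmorph_ext n (B : comNzRingType) (f g : {rmorphism {mpoly K[n]} -> B}) :
  (forall c, f c%:MP = g c%:MP) -> (forall i, f 'X_i = g 'X_i) -> f =1 g.
Proof.
move=> fC fX p; rewrite [p]mpolyE !rmorph_sum.
apply: eq_bigr => m _; rewrite -mul_mpolyC !rmorphM fC mpolyXE_id !rmorph_prod.
by congr (_ * _); apply: eq_bigr => i _; rewrite !rmorphXn fX.
Qed.

Definition poly_to_mpoly n : {poly {mpoly K[n]}} -> {mpoly K[n.+1]} :=
  horner_eval 'X_ord_max \o map_poly (@mwiden n K).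
HB.instance Definition _ n := GRing.RMorphism.on (@poly_to_mpoly n).

Lemma muniXm n (m : 'X_{1..n.+1}) : muni ('X_[m] : {mpoly K[n.+1]}) =
  'X_[[multinom m (widen_ord (leqnSn n) i) | i < n]] *: 'X^(m ord_max).
Proof. by rewrite muniE msuppX big_seq1 mcoeffX eqxx scale1r. Qed.

Lemma muni_widen n (p : {mpoly K[n]}) : muni (mwiden p) = p%:P.
Proof.
apply: (@mpoly_rmorph_ext _ _ (@muni n K \o @mwiden n K) polyC) => [c|i] /=.
  by rewrite mwidenC muniC.
rewrite mwidenX muniXm mnmwiden_ordmax expr0 alg_polyC; congr ('X_[_])%:P.
by apply/mnmP => j; rewrite mnmE mnmwiden_widen.
Qed.

Lemma poly_to_mpolyE n (p : {poly {mpoly K[n]}}) :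
  poly_to_mpoly p = (map_poly (@mwiden n K) p).['X_ord_max].
Proof. by []. Qed.

Lemma poly_to_mpolyK n : cancel (@poly_to_mpoly n) (@muni n K).
Proof.
move=> p; rewrite poly_to_mpolyE horner_coef rmorph_sum /=.
rewrite size_map_inj_poly ?mwiden0 //; last exact: inj_mwiden.
rewrite -[RHS]coefK poly_def; apply: eq_bigr => i _.
rewrite coef_map rmorphM /= muni_widen rmorphXn /= muniXm mnm1E eqxx expr1.
rewrite (_ : [multinom _ | j < n] = 0%MM) ?mpolyX0 ?scale1r ?mul_polyC //.
apply/mnmP => j; rewrite mnmE mnm1E mnm0E; apply/eqP; rewrite eqb0 eq_sym.
by rewrite -val_eqE /= ltn_eqF.
Qed.

Lemma muniK n : cancel (@muni n K) (@poly_to_mpoly n).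
Proof.
apply: (@mpoly_rmorph_ext _ _ (@poly_to_mpoly n \o @muni n K) idfun) => [c|i] /=.
  by rewrite muniC poly_to_mpolyE map_polyC /= mwidenC hornerC.
rewrite muniXm poly_to_mpolyE map_polyZ map_polyXn hornerZ hornerXn.
rewrite /= mwidenX mpolyXn -mpolyXD; congr 'X_[_]; apply/mnmP => j.
rewrite mnmDE mulmnE !mnm1E; have [j'|] := unliftP ord_max j; last first.
  by move=> ->; rewrite mnmwiden_ordmax eqxx mul1n.
have -> : lift ord_max j' = widen_ord (leqnSn n) j'.
  by apply: val_inj; rewrite /= /bump leqNgt ltn_ord.
move=> ->; rewrite mnmwiden_widen mnmE mnm1E -[ord_max == _]val_eqE /=.
by rewrite gtn_eqF // addn0.
Qed.

Lemma mpoly_has_gcds n : has_gcds {mpoly K[n]}.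
Proof.
elim: n => [|n IHn].
  apply: (@has_gcds_can _ K (mcoeff 0%MM) (@mpolyC 0 K)); last exact: field_has_gcds.
    exact: mpolyKC.
  exact: mpolyCK.
exact: has_gcds_can (@muniK n) (@poly_to_mpolyK n) (poly_has_gcds IHn).
Qed.
End MpolyGcd.

Import monalg.

(** * Rank and Fitting ideals of free abelian groups *)

Lemma additive_rV_mx m n (f : {additive 'rV[int]_m -> 'rV[int]_n}) :
  exists A : 'M_(m, n), forall u, f u = u *m A.
Proof.
exists (\matrix_i f (delta_mx 0 i)) => u.
rewrite mulmx_sum_row {1}[u]row_sum_delta raddf_sum; apply: eq_bigr => i _.
by rewrite rowK -[u 0 i]intz !scaler_int raddfMz.
Qed.

(** Over the integers a wide enough matrix has a nonzero left kernel: in Smith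
normal form its last row vanishes. *)
Lemma additive_rV_inj_leq m n (f : {additive 'rV[int]_m -> 'rV[int]_n}) :
  injective f -> (m <= n)%N.
Proof.
move=> finj; rewrite leqNgt; apply/negP => nm.
have [A fA] := additive_rV_mx f.
have [L Lu [R Ru [d _ AE]]] := int_Smith_normal_form A.
pose e : 'rV[int]_m := delta_mx 0 (Ordinal nm).
have e0 : e *m invmx L = 0.
  apply: finj; rewrite raddf0 fA AE !mulmxA mulmxKV // -rowE.
  rewrite [row _ _](_ : _ = 0) ?mul0mx //; apply/rowP => j; rewrite !mxE /=.
  by rewrite gtn_eqF // mulr0n.
have : e = 0 by rewrite -[e](mulmxKV Lu) e0 mul0mx.
by move=> /matrixP/(_ 0 (Ordinal nm)); rewrite !mxE !eqxx.
Qed.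

Lemma is_rank_unique (G : nmodType) r s : is_rank G r -> is_rank G s -> r = s.
Proof.
move=> [[f fi] rmax] [[g gi] smax]; apply/eqP.
by rewrite eqn_leq (smax _ f fi) (rmax _ g gi).
Qed.

Lemma rank_free (G : nmodType) r (f : {additive 'rV[int]_r -> G}) :
  injective f -> (forall g, exists u, f u = g) -> rank G = r.
Proof.
move=> fi fs; have rG : is_rank G r.
  split=> [|s h hi]; first by exists f.
  have /choice[k kE] g : exists u, f u = g by exact: fs.
  have kadd : nmod_morphism (k \o h).
    by split=> [|x y] /=; apply: fi; rewrite ?raddfD /= !kE ?raddf0 // raddfD.
  pose kh := GRing.isNmodMorphism.Build _ _ _ kadd.
  pose kha : {additive 'rV[int]_s -> 'rV[int]_r} := HB.pack (k \o h) kh.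
  apply: (additive_rV_inj_leq (f := kha)) => x y /= e.
  by apply: hi; rewrite -[h x]kE -[h y]kE e.
rewrite /rank; case: xgetP => [s _ /= sG|/(_ r)//].
exact: is_rank_unique sG rG.
Qed.

Lemma ideal_generated_sub (R : comNzRingType) (S T : set R) :
  T 0 -> (forall x y, T x -> T y -> T (x + y)) ->
  (forall a x, S x -> T (a * x)) -> ideal_generated S `<=` T.
Proof.
move=> T0 TD ST _ [k [a [s [Ss ->]]]]; elim/big_ind: _ => // i _.
exact/ST/Ss.
Qed.

(** The relation matrix [A] of a presentation of a free group of rank [s] is
killed on the right by an integer matrix with a left inverse, so its rational
rank is at most the number of generators minus [s]. *)
Lemma minor_ideal_free (G : nmodType) s (f : {additive 'rV[int]_s -> G}) m n
    (A : 'M[int]_(m, n)) r :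
  injective f -> (forall g, exists u, f u = g) -> presents A G ->
  (r < s)%N -> minor_ideal (n - r) A `<=` [set 0].
Proof.
move=> fi fs [h [hs hA]] rs.
have /choice[k kE] g : exists u, f u = g by exact: fs.
have kadd : nmod_morphism (k \o h).
  by split=> [|x y] /=; apply: fi; rewrite ?raddfD /= !kE ?raddf0 // raddfD.
pose kh := GRing.isNmodMorphism.Build _ _ _ kadd.
pose kha : {additive 'rV[int]_n -> 'rV[int]_s} := HB.pack (k \o h) kh.
have [B kB] := additive_rV_mx kha.
have AB : A *m B = 0.
  apply/row_matrixP => i; rewrite row_mul -kB row0 -[RHS](raddf0 kha) /=.
  by congr k; apply/hA; exists (delta_mx 0 i); rewrite subr0 -rowE.
have [C CB] : exists C, C *m B = 1%:M.
  have /choice[c cE] g : exists u, h u = g by exact: hs.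
  exists (\matrix_i c (f (delta_mx 0 i))); apply/row_matrixP => i.
  rewrite row_mul rowK -kB /= cE rowE mulmx1; apply: fi.
  by rewrite kE.
have rB : (s <= \rank (map_mx (intr : int -> rat) B))%N.
  rewrite -{1}(mxrank1 rat s) -(map_mx1 (intr : {rmorphism int -> rat})) -CB.
  by rewrite map_mxM mxrankM_maxr.
have rA : (\rank (map_mx (intr : int -> rat) A) <= n - s)%N.
  have := @mulmx0_rank_max _ _ _ _ (map_mx (intr : int -> rat) A) (map_mx intr B).
  rewrite -map_mxM AB map_mx0 => /(_ erefl) le_n; rewrite leq_subRL //.
    by apply: leq_trans le_n; rewrite addnC leq_add2l.
  exact: leq_trans rB (rank_leq_row _).
have sn : (s <= n)%N by exact: leq_trans rB (rank_leq_row _).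
apply: ideal_generated_sub => // [x y -> ->|a _ [[g h'] _ <-]]; first by rewrite addr0.
rewrite [\det _](_ : _ = 0) ?mulr0 //=; apply/eqP.
rewrite -(intr_eq0 rat) -[_%:~R]det_map_mx; apply: contraLR rs => dn0.
rewrite -leqNgt -(leq_sub2lE r sn).
suff -> : (n - r <= n - s)%N by [].
have : map_mx (intr : int -> rat) (mxsub g h' A) \in unitmx by rewrite unitmxE unitfE.
rewrite -row_full_unit /row_full => /eqP <-; apply: leq_trans rA.
rewrite map_mxsub; set X := map_mx _ A.
have -> : mxsub g h' X = rowsub g (X *m colsub h' 1%:M).
  by rewrite mulmx_colsub mulmx1; apply/matrixP => i j; rewrite !mxE.
exact: leq_trans (mxrankS (rowsub_sub _ _)) (mxrankM_maxl _ _).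
Qed.

(** The Smith normal form of the row [w] is [(d, 0, ..., 0)], so [w] is [d] times an
integer vector, and primitivity forces [d] to be a unit. *)
Lemma primitive_vector_basis s (w : 'rV[int]_s.+1) :
  (forall (k : int) u, w = k *: u -> k \is a GRing.unit) ->
  exists2 R : 'M[int]_s.+1, R \in unitmx &
    exists2 e : int, e \is a GRing.unit & w = e *: (delta_mx 0 ord0 *m R).
Proof.
move=> prim.
have [L Lu [R Ru [d _ wE]]] := int_Smith_normal_form w.
exists R => //; exists (\det L * d`_0); last first.
  rewrite {1}wE scalemxAl; congr (_ *m R).
  rewrite [L]mx11_scalar det_scalar1 mul_scalar_mx -scalerA; congr (_ *: _).
  by apply/rowP => j; rewrite !mxE eqxx -val_eqE eq_sym; case: eqP; rewrite ?mulr1 ?mulr0.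
have d0u : d`_0 \is a GRing.unit.
  apply: (prim _ (L *m delta_mx 0 0 *m R)); rewrite {1}wE scalemxAl scalemxAr.
  congr (_ *m _ *m _); apply/matrixP => i j; rewrite !mxE ord1.
  by rewrite eqxx -val_eqE eq_sym; case: eqP; rewrite ?mulr1 ?mulr0.
by rewrite unitrM d0u andbT -unitmxE.
Qed.

Lemma presents_free (G : nmodType) s (f : {additive 'rV[int]_s -> G}) :
  injective f -> (forall g, exists u, f u = g) ->
  presents (0 : 'M[int]_(0, s)) G.
Proof.
move=> fi fs; exists f; split=> // u v; split=> [/fi ->|[c]].
  by exists 0; rewrite subrr mul0mx.
by rewrite mulmx0 => /eqP; rewrite subr_eq0 => /eqP ->.
Qed.

(** Modulo a primitive element [w] a free group of rank [r.+1] becomes free of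
rank [r], so the Fitting ideal of index [r] is the unit ideal for the quotient
and zero for the group itself. *)
Lemma torsion_number_primitive (G : nmodType) (w : G) s
    (f : {additive 'rV[int]_s -> G}) :
  injective f -> (forall g, exists u, f u = g) ->
  (forall (k : int) u, f (k *: u) = w -> k \is a GRing.unit) ->
  torsion_number w = 1%N.
Proof.
move=> fi fs prim; have [w0 w0E] := fs w.
case: s => [|s] in f fi fs prim w0 w0E *.
  by have := prim 0 w0; rewrite unitr0 scale0r -[0](thinmx0 w0) w0E => /(_ erefl).
have [R Ru [e eu w0R]] : exists2 R : 'M[int]_s.+1, R \in unitmx &
    exists2 e : int, e \is a GRing.unit & w0 = e *: (delta_mx 0 ord0 *m R).
  by apply: primitive_vector_basis => k u ku; apply: (prim k u); rewrite -ku.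
pose g (v : 'rV[int]_s) := cyclic_pi w (f ((row_mx (0 : 'rV_1) v : 'rV_(1 + s)) *m R)).
have gadd : nmod_morphism g.
  split=> [|u v]; first by rewrite /g row_mx0 mul0mx raddf0.
  by rewrite /g -[0 in LHS]addr0 -add_row_mx mulmxDl raddfD; exact: cyclic_piD.
pose gA : {additive 'rV[int]_s -> cyclic_quotient w} :=
  HB.pack g (GRing.isNmodMorphism.Build _ _ _ gadd).
have wE : w0 = (row_mx e%:M 0 : 'rV_(1 + s)) *m R.
  rewrite w0R scalemxAl; congr (_ *m _); apply/rowP => j; rewrite !mxE.
  by case: split_ordP => k ->; rewrite !mxE -val_eqE /= ?ord1 ?mulr1 ?mulr0.
have mulw a : w *+ a = f ((row_mx (e *+ a)%:M 0 : 'rV_(1 + s)) *m R).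
  rewrite -w0E -raddfMn wE; congr (f _); rewrite -[LHS]scaler_nat scalemxAl.
  by rewrite scale_row_mx scaler0 scale_scalar_mx mulr_natl.
have gi : injective gA.
  move=> u v /eqP/cyclic_piP[a [b]]; rewrite !mulw -!raddfD -!mulmxDl => /fi.
  move=> /(congr1 (mulmxr (invmx R))) /=; rewrite !mulmxK // !add_row_mx.
  by move=> /(congr1 (@rsubmx int 1 1 s)); rewrite !row_mxKr !addr0.
have gs x : exists v, gA v = x.
  elim/quotW: x => x; have [u <-] := fs x.
  pose u' : 'rV[int]_(1 + s) := u *m invmx R.
  exists (rsubmx u'); apply/eqP/cyclic_piP.
  have u'E : u = (row_mx (u' 0 (lshift s ord0))%:M (rsubmx u') : 'rV_(1 + s)) *m R.
    rewrite -[LHS](mulmxKV Ru) -/u'; congr (_ *m R).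
    by rewrite -{1}[u']hsubmxK [lsubmx u']mx11_scalar mxE.
  rewrite [in f u]u'E; set c := u' 0 _.
  (* The congruence that defines the quotient only adds natural multiples of [w],
     so the first coordinate of [u] is cancelled on the side given by its sign. *)
  have [a [b eab]] : exists a b : nat, e *+ a = c + e *+ b.
    have : e * (e^-1 * c) = c by rewrite mulVKr.
    case: (e^-1 * c) => k kE; first by exists k, 0%N; rewrite addr0 -kE -[Posz k]natz mulr_natr.
    by exists 0%N, k.+1; rewrite -kE NegzE mulrN -[Posz k.+1]natz mulr_natr addNr.
  exists a, b; rewrite !mulw -!raddfD -!mulmxDl !add_row_mx; congr (f (row_mx _ _ *m _)).
  by rewrite add0r eab raddfD.
have rG := rank_free gi gs; rewrite /torsion_number; cbv zeta; rewrite rG.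
have Gbar1 z : fitting_ideal s (cyclic_quotient w) z.
  exists 0%N, s, 0; split; first exact: presents_free gi gs.
  rewrite subnn; exists 1%N, (fun=> z), (fun=> 1); split; last by rewrite big_ord1 mulr1.
  move=> _; exists (id, widen_ord (leq0n s)) => //; exact: det_mx00.
have G0 : fitting_ideal s G `<=` [set 0].
  by move=> z [m [n [A [AG]]]]; exact: (minor_ideal_free fi fs AG (ltnSn s)).
have neGG : fitting_ideal s G <> fitting_ideal s (cyclic_quotient w).
  by move=> eGG; have := G0 1; rewrite eGG => /(_ (Gbar1 1)).
case: pselect => [/neGG//|neGG'] /=.
case: xgetP => [d _ /= dE|/(_ 1%N)/= []]; last first.
  by apply/seteqP; split=> z _ //; exists z; rewrite ?mul1r.
have [z _] : [set d%:Z * z | z in [set: int]] 1 by rewrite -dE.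
by move=> /(congr1 absz); rewrite abszM absz_nat => /eqP; rewrite muln_eq1 => /andP[/eqP].
Qed.

(** * Orders of elements for a linear weight *)

Section Orders.
Variables (K : fieldType) (disp : Order.disp_t) (P : finPOrderType disp).
Local Notation R := (join_meet_ring K P).
Local Notation M := {ffun option P -> int}.
Implicit Types (f g : R) (a b m : cone_point P).

Lemma suppM f g m : m \in msupp (f * g) ->
  exists a b, [/\ a \in msupp f, b \in msupp g & m = cone_mul a b].
Proof. exact: msuppM_le. Qed.

Lemma supp_monomial a m : (m \in msupp (monomial K a)) = (m == a).
Proof. by rewrite msuppU1 in_fset1. Qed.

Lemma supp_neq0 f : f != 0 -> exists m, m \in msupp f.
Proof.
by rewrite -(msupp_eq0 f) => /fset0Pn.
Qed.

Lemma supp_part (p : pred (cone_point P)) f :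
  exists g : R, forall m, g@_m = if p m then f@_m else 0.
Proof.
exists [malg m in msupp f => if p m then f@_m else 0] => m.
by rewrite mcoeffE; case: msuppP => // _; rewrite if_same.
Qed.

Variable phi : M -> int.
Hypothesis phiD : forall u v, phi (u + v) = phi u + phi v.

(** [order_ge psi k] and [is_order k] say that the least weight of a monomial is at
least, respectively equal to, [k].  The weight [psi] is an explicit argument because
the proof below compares the weights [phi] and [- phi]. *)
Definition order_ge (psi : M -> int) (k : int) f :=
  forall m, m \in msupp f -> k <= psi (exponent m).

Lemma order_geM psi k l f g : (forall u v, psi (u + v) = psi u + psi v) ->
  order_ge psi k f -> order_ge psi l g -> order_ge psi (k + l) (f * g).
Proof.
move=> psiD fk gl m /suppM[a [b [/fk ka /gl lb ->]]] /=.
by rewrite psiD lerD.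
Qed.

Lemma order_geB psi k f g :
  order_ge psi k f -> order_ge psi k g -> order_ge psi k (f - g).
Proof.
by move=> fk gk m /(fsubsetP (msuppB_le _ _)); rewrite in_fsetU => /orP[/fk|/gk].
Qed.

Lemma order_ge_le psi k l f : l <= k -> order_ge psi k f -> order_ge psi l f.
Proof. by move=> lk fk m /fk; exact: le_trans. Qed.

Definition is_order f k :=
  order_ge phi k f /\ exists2 m, m \in msupp f & phi (exponent m) = k.

Lemma is_order_exists f : f != 0 -> exists k, is_order f k.
Proof.
move=> /supp_neq0[m0 m0f].
have [m mf mmin] : exists2 m, m \in msupp f &
    forall n, n \in msupp f -> phi (exponent m) <= phi (exponent n).
  have [i _ imin] := @arg_minP _ _ (msupp f) [` m0f]%fset predT
    (fun i => phi (exponent (val i))) isT.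
  by exists (val i); [exact: valP | move=> n nf; exact: (imin [` nf]%fset)].
by exists (phi (exponent m)); split=> //; exists m.
Qed.

Lemma is_order_unique f k l : is_order f k -> is_order f l -> k = l.
Proof.
move=> [fk [m mf mk]] [fl [n nf nl]]; apply/eqP.
by rewrite eq_le -{1}nl -{2}mk fk // fl.
Qed.

Lemma supp_order_part f (p : pred (cone_point P)) g :
  (forall m, g@_m = if p m then f@_m else 0) ->
  forall m, m \in msupp g -> p m /\ m \in msupp f.
Proof. by move=> gE m; rewrite -!mcoeff_neq0 gE; case: (p m); rewrite ?eqxx. Qed.

(** The order of a product is the sum of the orders, as for any grading of a
domain: the product of the two components of least weight is not zero, and
nothing else in the expansion of the product has its weight. *)
Lemma is_orderM f g k l : is_order f k -> is_order g l -> is_order (f * g) (k + l).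
Proof.
have low h n : is_order h n -> exists2 h0, h0 != 0 &
    order_ge (fun u => - phi u) (- n) h0 /\ order_ge phi (n + 1) (h - h0).
  (* [h0] is the component of least weight of [h]. *)
  move=> [hn [m mh mn]].
  have [h0 h0E] := supp_part (fun m => phi (exponent m) == n) h; exists h0.
    apply: contraTneq mh => h00; rewrite -mcoeff_eq0; have := h0E m.
    by rewrite mn eqxx h00 mcoeff0 => <-.
  split=> [a /(supp_order_part h0E)[/eqP <-]//|a].
  rewrite -mcoeff_neq0 mcoeffB h0E; case: (eqVneq (phi _)) => [_|an]; first by rewrite subrr eqxx.
  by rewrite subr0 mcoeff_neq0 => /hn na; rewrite lezD1 lt_neqAle eq_sym an.
move=> fk gl; split; first by apply: order_geM phiD _ _; [case: fk | case: gl].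
have [f0 f00 [f0k f1k]] := low f k fk; have [g0 g00 [g0l g1l]] := low g l gl.
have [fgm|] := pselect (order_ge phi (k + l + 1) (f * g)); last first.
  move=> /existsNP[m /not_implyP[mfg /negP]]; rewrite -ltNge ltzD1 => mkl.
  exists m => //; apply/eqP; rewrite eq_le mkl /=.
  by apply: (order_geM phiD _ _ mfg); [case: fk | case: gl].
have /supp_neq0[m mfg] : f0 * g0 != 0 by rewrite mulf_neq0.
have f0_ge : order_ge phi k f0.
  rewrite -[f0](subKr f); apply: order_geB; first by case: fk.
  by apply: order_ge_le f1k; rewrite lerDl.
have : k + l + 1 <= phi (exponent m).
  move: m mfg; rewrite -/(order_ge phi (k + l + 1) (f0 * g0)).
  have -> : f0 * g0 = f * g - (f - f0) * g - f0 * (g - g0).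
    by rewrite mulrBl subKr mulrBr subKr.
  apply: order_geB; first (apply: order_geB; first exact: fgm).
    by rewrite addrAC; apply: (order_geM phiD f1k); case: gl.
  by rewrite -addrA; exact: (order_geM phiD f0_ge g1l).
have phiN u v : - phi (u + v) = - phi u + - phi v by rewrite phiD opprD.
have := order_geM phiN f0k g0l mfg; rewrite -opprD lerN2.
by move=> hi lo; have := le_trans lo hi; rewrite gerDl ler10.
Qed.
End Orders.

(** * Lattice points with prescribed values on the edges *)

Section ConePoints.
Variables (disp : Order.disp_t) (P : finPOrderType disp).
Local Notation M := {ffun option P -> int}.
Implicit Types (x y s t : hat P) (u v z : M) (b : hat P -> hat P -> int).

(** The coordinate at the top is [0] by convention, hence the normalization. *)
Definition point_of (h : hat P -> int) : M :=
  [ffun i => h (if i is Some p then Elt p else Bot P) - h (Top P)].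

Lemma edge_form_point_of x y h : edge_form x y (point_of h) = h x - h y.
Proof.
have coordE t : hat_coord (point_of h) t = h t - h (Top P).
  by case: t => [|p|] /=; rewrite ?ffunE // subrr.
by rewrite /edge_form !coordE opprB addrA subrK.
Qed.

Lemma edge_formMn x y z n : edge_form x y (z *+ n) = edge_form x y z *+ n.
Proof.
elim: n => [|n IHn]; last by rewrite !mulrS edge_formD IHn.
by rewrite !mulr0n -(subrr z) edge_formD edge_formN subrr.
Qed.

Lemma dominating_point b :
  exists a : cone_point P, forall x y, hasse x y -> b x y <= edge_form x y (exponent a).
Proof.
pose N := (\sum_(xy : hat P * hat P) `|b xy.1 xy.2|)%N.
have upE x y : hasse x y -> `|b x y|%:Z <= edge_form x y (up_point P int *+ N).
  move=> xy; have := in_interiorP _ (up_point_interior P int) x y xy.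
  rewrite edge_formMn gtz0_ge1 => /(ler_wMn2r N); apply: le_trans.
  by rewrite -mulr_natr mul1r natz lez_nat /N (bigD1 (x, y)) //= leq_addr.
have Cz : in_cone (up_point P int *+ N).
  by apply/in_coneP => x y /upE; exact: le_trans.
by exists (ConePoint Cz) => x y xy; apply: le_trans (upE x y xy); exact: ler_norm.
Qed.

Lemma hat_ltW_trans y x t : hat_lt x y -> (y == t) || hat_lt y t -> hat_lt x t.
Proof. by move=> xy /orP[/eqP <-//|]; exact: hat_lt_trans. Qed.

(** A function that decreases strictly along every edge but one, obtained by
counting upper bounds after the two ends of that edge have been identified. *)
Lemma facet_function x y : hasse x y -> exists h : hat P -> int,
  h x = h y /\ forall s t, hasse s t -> (s, t) <> (x, y) -> h t < h s.
Proof.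
move=> xy; have [xy_lt /forallP xyN] := andP xy.
pose le s t := (s == t) || hat_lt s t.
have le_refl s : le s s by rewrite /le eqxx.
have le_tr t s r : le s t -> le t r -> le s r.
  by rewrite /le => /orP[/eqP ->//|st] tr; rewrite (hat_ltW_trans st tr) orbT.
pose le' s t := le s t || (le s y && le x t).
have le'_trans t s r : le' s t -> le' t r -> le' s r.
  rewrite /le' => /orP[st|/andP[sy xt]] /orP[tr|/andP[ty xr]].
  - by rewrite (le_tr _ _ _ st tr).
  - by rewrite (le_tr _ _ _ st ty) xr orbT.
  - by rewrite sy (le_tr _ _ _ xt tr) orbT.
  - by rewrite sy xr orbT.
pose h s := #|[pred t | le' s t]|%:Z.
have h_le s t : le' s t -> h t <= h s.
  move=> st; rewrite lez_nat; apply: subset_leq_card; apply/fintype.subsetP => r.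
  by rewrite !inE; exact: le'_trans.
exists h; split=> [|s t /andP[st /forallP stN] ne].
  by apply/le_anti/andP; split; apply: h_le; rewrite /le' /le ?eqxx ?xy_lt ?orbT.
rewrite ltz_nat; apply: proper_card; apply/properP; split.
  apply/fintype.subsetP => r; rewrite !inE; apply: le'_trans.
  by rewrite /le' /le st orbT.
exists s; rewrite !inE /le' ?le_refl //.
apply/negP => /orP[/(hat_ltW_trans st)|/andP[ty xs]]; first by rewrite hat_lt_irr.
have sy := hat_ltW_trans st ty.
case/orP: xs => [/eqP xs|xs]; last by have := xyN s; rewrite xs sy.
case/orP: ty => [/eqP ty|ty]; first by case: ne; rewrite xs ty.
by have := xyN t; rewrite ty xs st.
Qed.

(** The point with only nonzero coordinate [b x y] at [x] has the right value on the
edge [(x, y)]; adding a large multiple of a lattice point in the relative interior of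
the facet of that edge makes the other values as large as needed. *)
Lemma tight_point b x y : hasse x y -> exists z : M,
  edge_form x y z = b x y /\ forall s t, hasse s t -> b s t <= edge_form s t z.
Proof.
move=> xy; have [h [hxy hlt]] := facet_function xy.
pose N := \sum_(st : hat P * hat P) `|b st.1 st.2| + `|b x y|.
pose g t := b x y * (t == x)%:R + N * h t.
have gE s t : edge_form s t (point_of g) =
    b x y * ((s == x)%:R - (t == x)%:R) + N * (h s - h t).
  by rewrite edge_form_point_of /g opprD addrACA -!mulrBr.
have gxy : edge_form x y (point_of g) = b x y.
  have yx : y == x = false.
    by apply/eqP => yx; have := proj1 (andP xy); rewrite yx hat_lt_irr.
  by rewrite gE hxy subrr mulr0 addr0 eqxx yx subr0 mulr1.
exists (point_of g); split=> // s t st.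
have [[-> ->]|ne] := pselect ((s, t) = (x, y)); first by rewrite gxy.
have N0 : 0 <= N by rewrite addr_ge0 ?sumr_ge0.
have le_N : b s t <= N - `|b x y|.
  rewrite addrK (bigD1 (s, t)) //=; apply: le_trans (ler_norm _) _.
  by rewrite lerDl sumr_ge0.
apply: le_trans le_N _; rewrite gE addrC lerD //.
  have : `|b x y * ((s == x)%:R - (t == x)%:R)| <= `|b x y|.
    rewrite normrM ler_piMr //.
    by case: (s == x); case: (t == x); rewrite /= ?subrr ?subr0 ?sub0r ?normrN ?normr1 ?normr0.
  by rewrite ler_norml => /andP[].
by rewrite ler_peMr // -gtz0_ge1 subr_gt0 hlt.
Qed.

End ConePoints.

(** * Valuations on the field of fractions *)

Lemma mulf_divK (E : fieldType) (h x g : E) : g != 0 -> h * g * (x / g) = h * x.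
Proof. by move=> g0; rewrite mulrA mulrAC (mulfK g0). Qed.

Section FractionArithmetic.
Variable A : idomainType.
Implicit Types (a c d f g p q r : A) (x : {fraction A}).

Lemma tofrac_inj : injective (@tofrac A).
Proof. by move=> f g /eqP; rewrite tofrac_eq => /eqP. Qed.

Lemma fraction_eqP f g p q : g != 0 -> q != 0 ->
  f%:F / g%:F = p%:F / q%:F <-> f * q = p * g.
Proof.
move=> g0 q0; split=> [|e].
  move=> /eqP; rewrite eqr_div ?tofrac_eq0 // -!tofracM => /eqP.
  exact: tofrac_inj.
by apply/eqP; rewrite eqr_div ?tofrac_eq0 // -!tofracM e.
Qed.

Lemma fraction_mul f g p q :
  (f%:F / g%:F) * (p%:F / q%:F) = (f * p)%:F / (g * q)%:F.
Proof. by rewrite !tofracM mulf_div. Qed.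

Lemma fraction_scaled_neq0 a f x :
  a != 0 -> x != 0 -> a%:F * x = f%:F -> f != 0.
Proof.
by move=> a0 x0 e; rewrite -tofrac_eq0 -e mulf_neq0 ?tofrac_eq0.
Qed.

Lemma fraction_scaled_inv a c f g x :
  x != 0 -> a%:F * x = f%:F -> c%:F * x^-1 = g%:F -> f * g = a * c.
Proof.
move=> x0 fE gE; apply: tofrac_inj; rewrite !tofracM -fE -gE.
by rewrite mulrACA mulfV // mulr1.
Qed.

Lemma fraction_scaled_div c d f q r x : d != 0 -> r != 0 ->
  d%:F * x = f%:F -> c * f = q * r -> c%:F * (x / (r%:F / d%:F)) = q%:F.
Proof.
move=> d0 r0 fE e; have rF0 : r%:F != 0 :> {fraction A} by rewrite tofrac_eq0.
apply: (mulIf rF0); rewrite -tofracM -e tofracM -fE -mulrA; congr (_ * _).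
by rewrite invf_div mulrA (divfK rF0) mulrC.
Qed.

Lemma fraction_scaled_mul d f g p q x : q != 0 ->
  d%:F * x = f%:F -> p%:F / q%:F * x = g%:F -> p * f = g * (q * d).
Proof.
move=> q0 fE gE; apply: tofrac_inj; rewrite !tofracM -fE -gE.
by rewrite [RHS]mulrACA mulfVK ?tofrac_eq0 // [x * _]mulrC.
Qed.

Lemma fraction_mul_eq c d p q r s : q != 0 -> d != 0 ->
  c * (p * r) = s * (q * d) -> c%:F * (p%:F / q%:F * (r%:F / d%:F)) = s%:F.
Proof.
move=> q0 d0 e; have qd0 : (q * d)%:F != 0 :> {fraction A}.
  by rewrite tofrac_eq0 mulf_neq0.
apply: (mulIf qd0); rewrite -tofracM -e tofracM mulf_div -!tofracM.
by rewrite -[LHS]mulrA (divfK qd0) !tofracM.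
Qed.

Lemma fscaleV_mem (I : set {fraction A}) (g x : {fraction A}) :
  g != 0 -> fscale g^-1 I x <-> I (x * g).
Proof.
move=> g0; split=> [[y Iy <-]|Ix]; first by rewrite mulrC mulrA mulfV ?mul1r.
by exists (x * g) => //; rewrite mulrC mulfK.
Qed.
End FractionArithmetic.

Section Fractions.
Variables (K : fieldType) (disp : Order.disp_t) (P : finPOrderType disp).
Local Notation R := (join_meet_ring K P).
Local Notation F := {fraction R}.
Local Notation M := {ffun option P -> int}.
Implicit Types (f g : R) (a c m : cone_point P) (x y : F) (z u : M).
Implicit Types (s t : hat P) (b : hat P -> hat P -> int) (phi : M -> int).

Local Notation X a := ((monomial K a)%:F : F).

Lemma monomial_neq0 a : monomial K a != 0.
Proof. by rewrite monalgU_eq0 oner_eq0. Qed.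

Lemma monomialM a c : monomial K (cone_mul a c) = monomial K a * monomial K c.
Proof. by rewrite [RHS]malgM_def fgmulUU mulr1. Qed.

Lemma tofrac_monomialM a c : X (cone_mul a c) = X a * X c.
Proof. by rewrite monomialM; exact: tofracM. Qed.

Lemma tofrac_monomial1 : X (cone_one P) = 1.
Proof. exact: tofrac1. Qed.

Lemma tofrac_monomial_neq0 a : X a != 0.
Proof. by rewrite tofrac_eq0 monomial_neq0. Qed.

Lemma is_order_monomial phi a : is_order phi (monomial K a) (phi (exponent a)).
Proof.
split=> [m|]; first by rewrite supp_monomial => /eqP ->.
by exists a; rewrite ?supp_monomial.
Qed.

(** The extension of the order for [phi] to a valuation of the field of fractions; its
value at [0] is meaningless. *)
Definition is_val phi x k := exists f g, exists kf kg,
  [/\ g != 0, x = f%:F / g%:F, is_order phi f kf, is_order phi g kg & k = kf - kg].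

Definition val_at phi x : int := xget 0 [set k | is_val phi x k].

Lemma fraction_form x : exists f g, g != 0 /\ x = f%:F / g%:F.
Proof.
have [g g0 [f fE]] := frac_denom x; exists f, g; split=> //.
by rewrite -fE mulrAC mulfV ?mul1r // tofrac_eq0.
Qed.

Section Additive.
Variable phi : M -> int.
Hypothesis phiD : forall u v, phi (u + v) = phi u + phi v.

Lemma is_val_unique x k l : is_val phi x k -> is_val phi x l -> k = l.
Proof.
move=> [f [g [kf [kg [g0 -> fk gk ->]]]]] [f' [g' [lf [lg [g'0 e fl gl ->]]]]].
have fg : f * g' = f' * g.
  exact: (proj1 (fraction_eqP _ _ g0 g'0)) e.
have := is_order_unique (is_orderM phiD fk gl).
rewrite fg => /(_ _ (is_orderM phiD fl gk)) h.
by apply/eqP; rewrite subr_eq addrAC eq_sym subr_eq eq_sym h.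
Qed.

Lemma is_val_exists x : x != 0 -> exists k, is_val phi x k.
Proof.
have [f [g [g0 ->]]] := fraction_form x; move=> x0.
have f0 : f != 0 by apply: contraNneq x0 => ->; rewrite tofrac0 mul0r.
have [kf fk] := is_order_exists phi f0; have [kg gk] := is_order_exists phi g0.
by exists (kf - kg), f, g, kf, kg.
Qed.

Lemma val_atP x : x != 0 -> is_val phi x (val_at phi x).
Proof.
move=> /is_val_exists[k xk]; rewrite /val_at; case: xgetP => [l _ //|/(_ k)].
by case.
Qed.

Lemma val_atE x k : is_val phi x k -> val_at phi x = k.
Proof.
move=> xk; rewrite /val_at; case: xgetP => [l _ xl|/(_ k)//].
exact: is_val_unique xl xk.
Qed.

Lemma val_atM x y : x != 0 -> y != 0 -> val_at phi (x * y) = val_at phi x + val_at phi y.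
Proof.
move=> /val_atP[f [g [kf [kg [g0 xE fk gk ->]]]]].
move=> /val_atP[f' [g' [kf' [kg' [g'0 yE fk' gk' ->]]]]].
apply: val_atE; exists (f * f'), (g * g'), (kf + kf'), (kg + kg'); split.
- by rewrite mulf_neq0.
- by rewrite xE yE; exact: fraction_mul.
- exact: is_orderM.
- exact: is_orderM.
- by rewrite opprD addrACA.
Qed.

Lemma phi0 : phi 0 = 0.
Proof. by apply: (addrI (phi 0)); rewrite -phiD !addr0. Qed.

Lemma val_tofrac f k : is_order phi f k -> val_at phi f%:F = k.
Proof.
move=> fk; apply: val_atE; exists f, (monomial K (cone_one P)), k, 0; split.
- exact: monomial_neq0.
- by rewrite tofrac_monomial1 divr1.
- by [].
- by rewrite -phi0; exact: is_order_monomial.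
- by rewrite subr0.
Qed.

Lemma val_monomial a : val_at phi (X a) = phi (exponent a).
Proof. exact/val_tofrac/is_order_monomial. Qed.

Lemma val_atV x : x != 0 -> val_at phi x^-1 = - val_at phi x.
Proof.
move=> x0; apply: (addrI (val_at phi x)); rewrite -val_atM ?invr_neq0 // mulfV //.
by rewrite -tofrac_monomial1 val_monomial phi0 subrr.
Qed.
End Additive.

(** The Laurent polynomials, as the fractions with a monomial denominator. *)
Definition laurent x := exists a, in_base (X a * x).

Lemma laurentM x y : laurent x -> laurent y -> laurent (x * y).
Proof.
move=> [a xa] [c yc]; exists (cone_mul a c).
by rewrite tofrac_monomialM mulrACA; exact: in_baseM.
Qed.

Lemma in_base_laurent x : in_base x -> laurent x.
Proof.
by move=> xR; exists (cone_one P); apply: in_baseM => //; exact: in_base_tofrac.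
Qed.

Lemma laurent_monomialV a : laurent (X a)^-1.
Proof.
by exists a; rewrite mulfV ?tofrac_monomial_neq0 //; exists 1; rewrite tofrac1.
Qed.

Lemma cone_difference z :
  exists ac : cone_point P * cone_point P, exponent ac.1 = z + exponent ac.2.
Proof.
have [c cz] := dominating_point (fun s t => - edge_form s t z).
have Ca : in_cone (z + exponent c).
  by apply/in_coneP => s t st; rewrite edge_formD -lerBlDl sub0r cz.
by exists (ConePoint Ca, c).
Qed.

(** The monomial with an arbitrary exponent vector, as a quotient of two monomials with
exponents in the cone; [laurent_monomialE] shows that the choice does not matter. *)
Definition laurent_monomial z : F :=
  let ac := projT1 (cid (cone_difference z)) in X ac.1 / X ac.2.

Lemma laurent_monomialE z a c :
  exponent a = z + exponent c -> laurent_monomial z = X a / X c.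
Proof.
move=> az; rewrite /laurent_monomial; case: cid => -[a' c'] /= a'z.
apply/fraction_eqP; [exact: monomial_neq0 | exact: monomial_neq0 |].
rewrite -!monomialM (_ : cone_mul a' c = cone_mul a c') //.
by apply: val_inj; rewrite /= az a'z addrAC.
Qed.

Lemma laurent_monomial_neq0 z : laurent_monomial z != 0.
Proof. by rewrite mulf_neq0 ?invr_eq0 ?tofrac_monomial_neq0. Qed.

Lemma laurent_laurent_monomial z : laurent (laurent_monomial z).
Proof.
by apply: laurentM; [exact/in_base_laurent/in_base_tofrac | exact: laurent_monomialV].
Qed.

Lemma laurent_monomial_exponent a : laurent_monomial (exponent a) = X a.
Proof.
rewrite (@laurent_monomialE _ a (cone_one P)) ?addr0 //.
by rewrite tofrac_monomial1 divr1.
Qed.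

Lemma laurent_monomialD u z :
  laurent_monomial (u + z) = laurent_monomial u * laurent_monomial z.
Proof.
have [[a c] /= au] := cone_difference u; have [[a' c'] /= az] := cone_difference z.
rewrite (laurent_monomialE au) (laurent_monomialE az) fraction_mul.
rewrite -(monomialM a a') -(monomialM c c'); apply: laurent_monomialE.
by rewrite /= au az addrACA.
Qed.

Lemma laurent_monomial0 : laurent_monomial 0 = 1.
Proof.
rewrite (@laurent_monomialE _ (cone_one P) (cone_one P)) ?add0r //.
by rewrite mulfV // tofrac_monomial_neq0.
Qed.

Lemma laurent_monomialN z : laurent_monomial (- z) = (laurent_monomial z)^-1.
Proof.
apply: (mulfI (laurent_monomial_neq0 z)).
by rewrite -laurent_monomialD subrr laurent_monomial0 mulfV ?laurent_monomial_neq0.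
Qed.

Lemma val_laurent_monomial phi z : (forall u v, phi (u + v) = phi u + phi v) ->
  val_at phi (laurent_monomial z) = phi z.
Proof.
move=> phiD; have [[a c] /= az] := cone_difference z.
rewrite (laurent_monomialE az) val_atM ?invr_eq0 ?tofrac_monomial_neq0 //.
by rewrite val_atV ?tofrac_monomial_neq0 // !val_monomial // az phiD addrK.
Qed.
End Fractions.

(** * Divisorial ideals defined by bounds on the edge valuations *)

Section ConeIdeals.
Variables (K : fieldType) (disp : Order.disp_t) (P : finPOrderType disp).
Local Notation R := (join_meet_ring K P).
Local Notation F := {fraction R}.
Local Notation M := {ffun option P -> int}.
Implicit Types (f g : R) (a c m : cone_point P) (x y : F) (z u : M).
Implicit Types (s t : hat P) (b d : hat P -> hat P -> int).

Local Notation X a := ((monomial K a)%:F : F).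
Local Notation v s t := (val_at (@edge_form disp P int s t)).
Local Notation edgeD := (@edge_formD disp P int).

(** The intersection of the symbolic powers [p_e^(b_e)], where [p_e] is the height one
prime of the facet of the edge [e]. *)
Definition cone_ideal b : set F :=
  [set x | laurent x /\ (x != 0 -> forall s t, hasse s t -> b s t <= v s t x)].

Lemma cone_ideal_monomial b z :
  cone_ideal b (laurent_monomial K z) <->
  forall s t, hasse s t -> b s t <= edge_form s t z.
Proof.
split=> [[_ /(_ (laurent_monomial_neq0 K z)) h] s t /h|h].
  by rewrite (val_laurent_monomial _ _ (edgeD s t)).
split; first exact: laurent_laurent_monomial.
by move=> _ s t /h; rewrite (val_laurent_monomial _ _ (edgeD s t)).
Qed.

Lemma monomial_dvd f a :
  (forall m, m \in msupp f -> in_cone (exponent m - exponent a)) ->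
  exists f', f = monomial K a * f'.
Proof.
move=> fa.
pose q m : cone_point P := insubd (cone_one P) (exponent m - exponent a).
have qE m : m \in msupp f -> cone_mul a (q m) = m.
  by move=> /fa qm; apply: val_inj; rewrite /= insubdK // addrC subrK.
exists (\sum_(m <- msupp f) << f@_m *g q m >>).
rewrite {1}[f]monalgE mulr_sumr; apply: eq_big_seq => m /qE qm.
by rewrite [RHS]malgM_def fgmulUU mul1r; congr (<< _ *g _ >>); rewrite -[LHS]qm.
Qed.

(** Normality of the ring: it is cut out of the Laurent polynomial ring by the edge
valuations, since an exponent vector lies in the cone when all its edge forms are
nonnegative. *)
Lemma in_base_cone_ideal x : in_base x <-> cone_ideal (fun _ _ => 0) x.
Proof.
split=> [xR|[[a [f fE]] vx]].
  split=> [|x0 s t st]; first exact: in_base_laurent.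
  have [f fE] := xR; have f0 : f != 0 by rewrite -tofrac_eq0 -fE.
  have [k fk] := is_order_exists (@edge_form _ P int s t) f0.
  rewrite fE (val_tofrac (edgeD _ _) fk); have [_ [m mf <-]] := fk.
  exact: (in_coneP _ (exponent_cone m)).
have [->|x0] := eqVneq x 0; first by exists 0; rewrite tofrac0.
have [m mf|f' ff'] := @monomial_dvd f a; last first.
  exists f'; apply: (mulfI (tofrac_monomial_neq0 K a)).
  by rewrite fE ff'; exact: tofracM.
apply/in_coneP => s t st.
have f0 : f != 0 by apply: contraTneq mf => ->; rewrite msupp0.
have [k fk] := is_order_exists (@edge_form _ P int s t) f0.
rewrite edge_formD edge_formN subr_ge0.
apply: le_trans (proj1 fk m mf); rewrite -(val_tofrac (edgeD _ _) fk) -fE.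
rewrite (val_atM (edgeD s t) (tofrac_monomial_neq0 K a) x0) (val_monomial _ (edgeD s t)).
by rewrite lerDl; exact: vx.
Qed.

Lemma cone_ideal_neq0 b : exists2 x, cone_ideal b x & x != 0.
Proof.
have [a ab] := dominating_point b.
exists (laurent_monomial K (exponent a)); last exact: laurent_monomial_neq0.
exact/cone_ideal_monomial.
Qed.

Lemma cone_idealM b d e x y : (forall s t, hasse s t -> e s t <= b s t + d s t) ->
  cone_ideal b x -> cone_ideal d y -> cone_ideal e (x * y).
Proof.
move=> ebd [xL xb] [yL yd]; split; first exact: laurentM.
move=> xy0 s t st.
have x0 : x != 0 by apply: contraNneq xy0 => ->; rewrite mul0r.
have y0 : y != 0 by apply: contraNneq xy0 => ->; rewrite mulr0.
apply: le_trans (ebd s t st) _; rewrite (val_atM (edgeD s t) x0 y0).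
by apply: lerD; [exact: xb | exact: yd].
Qed.

Lemma cone_ideal_le b d x : (forall s t, hasse s t -> d s t <= b s t) ->
  cone_ideal b x -> cone_ideal d x.
Proof.
by move=> db [xL xb]; split=> // x0 s t st; apply: le_trans (db s t st) (xb _ _ _ _).
Qed.

Lemma eq_cone_ideal b d : (forall s t, hasse s t -> b s t = d s t) ->
  cone_ideal b = cone_ideal d.
Proof.
by move=> bd; apply/seteqP; split=> x; apply: cone_ideal_le => s t /bd ->.
Qed.

(** If multiplication by [x] sends the monomials of [cone_ideal b] into
[cone_ideal d], then [x] satisfies every inequality that this suggests, since
each inequality defining [cone_ideal b] is sharp on some monomial. *)
Lemma cone_ideal_colon b d x :
  (forall z, (forall s t, hasse s t -> b s t <= edge_form s t z) ->
    cone_ideal d (x * laurent_monomial K z)) ->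
  cone_ideal (fun s t => d s t - b s t) x.
Proof.
move=> xb; split=> [|x0 s t st].
  have [a ab] := dominating_point b; have [xaL _] := xb _ ab.
  rewrite -[x](mulfK (laurent_monomial_neq0 K (exponent a))).
  by rewrite -laurent_monomialN; apply: laurentM => //; exact: laurent_laurent_monomial.
have [z [zst zb]] := tight_point b st; have z0 := laurent_monomial_neq0 K z.
have [_ /(_ (mulf_neq0 x0 z0) s t st)] := xb z zb.
rewrite (val_atM (edgeD s t) x0 z0) (val_laurent_monomial _ _ (edgeD s t)).
by rewrite zst lerBlDr.
Qed.

Lemma finv_cone_ideal b : finv (cone_ideal b) = cone_ideal (fun s t => - b s t).
Proof.
apply/seteqP; split=> x xb.
  rewrite -(@eq_cone_ideal (fun s t => 0 - b s t)) => [|s t _]; last exact: sub0r.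
  apply: cone_ideal_colon => z zb.
  by apply/in_base_cone_ideal/xb/cone_ideal_monomial.
move=> y yb; apply/in_base_cone_ideal; apply: cone_idealM xb yb => s t _.
by rewrite addNr.
Qed.

Lemma vclosure_cone_ideal b : vclosure (cone_ideal b) = cone_ideal b.
Proof.
rewrite /vclosure !finv_cone_ideal; apply: eq_cone_ideal => s t _; exact: opprK.
Qed.

Lemma cone_ideal_vbounded b : vbounded (cone_ideal b).
Proof.
split; first exact: cone_ideal_neq0.
have [a ab] := dominating_point (fun s t => - b s t).
exists (monomial K a); first exact: monomial_neq0.
move=> x xb; apply/in_base_cone_ideal.
have aM : cone_ideal (fun s t => - b s t) (X a).
  by rewrite -laurent_monomial_exponent; exact/cone_ideal_monomial.
by apply: cone_idealM aM xb => s t _; rewrite addNr.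
Qed.

Lemma cone_ideal_divisorial b : divisorial (cone_ideal b).
Proof.
by rewrite -(vclosure_cone_ideal b); apply/vclosure_divisorial/cone_ideal_vbounded.
Qed.

Definition cone_divisor b : divisor R := Divisor (cone_ideal_divisorial b).
Definition cone_class b : class_group R := divisor_class (cone_divisor b).

Lemma cone_classD b d : cone_class (fun s t => b s t + d s t) = cone_class b + cone_class d.
Proof.
rewrite /cone_class -[RHS]divisor_classM; congr divisor_class.
apply: divisor_inj => /=; rewrite /vclosure.
rewrite (_ : finv (fprod _ _) = cone_ideal (fun s t => - (b s t + d s t))).
  by rewrite finv_cone_ideal; apply: eq_cone_ideal => s t _; rewrite opprK.
apply/seteqP; split=> x.
  move=> /finv_fprod xbd.
  rewrite -(@eq_cone_ideal (fun s t => - d s t - b s t)) => [|s t _]; last first.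
    by rewrite opprD addrC.
  apply: cone_ideal_colon => z /(cone_ideal_monomial b z)/xbd.
  by rewrite finv_cone_ideal.
move=> xbd; apply/finv_fprod => y yb; rewrite finv_cone_ideal.
by apply: cone_idealM xbd yb => s t _; rewrite opprD addrAC addNr add0r.
Qed.

Lemma cone_class0 : cone_class (fun _ _ => 0) = 0.
Proof.
rewrite /cone_class -[RHS]/(class_zero R); congr divisor_class.
by apply: divisor_inj => /=; apply/seteqP; split=> x /in_base_cone_ideal.
Qed.

(** A unit of the Laurent polynomial ring behaves like a monomial: for each
linear weight, the least weights of [x] and of its inverse add up to zero, and
so do the greatest ones, so the least and the greatest weight agree. *)
Lemma laurent_unit_val x : x != 0 -> laurent x -> laurent x^-1 ->
  exists z, forall s t, v s t x = edge_form s t z.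
Proof.
move=> x0 [a [f fE]] [c [g gE]].
have f0 := fraction_scaled_neq0 (monomial_neq0 K a) x0 fE.
have g0 := fraction_scaled_neq0 (monomial_neq0 K c) (invr_neq0 x0) gE.
have fgE : f * g = monomial K (cone_mul a c).
  by rewrite monomialM; exact: fraction_scaled_inv fE gE.
have [m mf] := supp_neq0 f0.
exists (exponent m - exponent a) => s t.
have [k fk] := is_order_exists (@edge_form _ P int s t) f0.
have [l gl] := is_order_exists (@edge_form _ P int s t) g0.
have negD u z : - edge_form s t (u + z) = - edge_form s t u - edge_form s t z.
  by rewrite edge_formD opprD.
have [k' fk'] := is_order_exists (fun z : M => - edge_form s t z) f0.
have [l' gl'] := is_order_exists (fun z : M => - edge_form s t z) g0.
have e1 := is_orderM (edgeD s t) fk gl; rewrite fgE in e1.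
have e2 := is_orderM negD fk' gl'; rewrite fgE in e2.
have klE := is_order_unique e1 (is_order_monomial K _ _).
have klE' := is_order_unique e2 (is_order_monomial K (fun z : M => - edge_form s t z) _).
have kk' : k <= - k' by case: fk => h _; case: fk' => _ [n nf <-]; rewrite opprK h.
have ll' : l <= - l' by case: gl => h _; case: gl' => _ [n nf <-]; rewrite opprK h.
have kE : edge_form s t (exponent m) = k.
  have km : k <= edge_form s t (exponent m) by case: fk => h _; exact: h.
  have mk : edge_form s t (exponent m) <= - k'.
    by rewrite lerNr; case: fk' => h _; exact: h.
  have : - k' <= k.
    rewrite -(lerD2r l); apply: le_trans (lerD (lexx (- k')) ll') _.
    by rewrite -opprD klE' opprK klE.
  by move=> /(le_trans mk) mk2; apply/eqP; rewrite eq_le mk2.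
rewrite edge_formD edge_formN kE -(val_tofrac (edgeD _ _) fk) -fE.
rewrite (val_atM (edgeD s t) (tofrac_monomial_neq0 K a) x0) (val_monomial _ (edgeD s t)).
by rewrite addrAC subrr add0r.
Qed.

(** A factor [x] between two such ideals and its inverse both satisfy the bounds of
[cone_ideal_colon]; these say that [x] is a unit of the Laurent polynomial ring and
that its edge valuations are exactly the differences of the bounds. *)
Lemma cone_class_eq b d : cone_class b = cone_class d <->
  exists z, forall s t, hasse s t -> b s t = d s t + edge_form s t z.
Proof.
split=> [/eqP/divisor_classP[x x0 /= bd]|[z bd]].
  have scaleP b' d' y : y != 0 -> cone_ideal b' = fscale y (cone_ideal d') ->
      cone_ideal (fun s t => b' s t - d' s t) y.
    move=> y0 e; apply: cone_ideal_colon => u /(cone_ideal_monomial d' u) du.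
    by rewrite e; exists (laurent_monomial K u).
  have db : cone_ideal d = fscale x^-1 (cone_ideal b).
    by rewrite bd fscaleA mulVf // fscale1.
  have [xL xv] := scaleP _ _ _ x0 bd.
  have x'0 : x^-1 != 0 by rewrite invr_eq0.
  have [x'L x'v] := scaleP _ _ _ x'0 db.
  have [z zv] := laurent_unit_val x0 xL x'L; exists z => s t st.
  have := xv x0 s t st; have := x'v x'0 s t st.
  rewrite (val_atV (edgeD s t) x0) lerNr opprB => h1 h2.
  by rewrite -zv addrC; apply/eqP; rewrite -subr_eq eq_le h1 h2.
apply/eqP/divisor_classP; exists (laurent_monomial K z); first exact: laurent_monomial_neq0.
apply/seteqP; split=> [x xb|_ [x xd <-]] /=.
  exists (laurent_monomial K (- z) * x); last first.
    by rewrite mulrA -laurent_monomialD subrr laurent_monomial0 mul1r.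
  have zM := proj2 (cone_ideal_monomial (fun s t => edge_form s t (- z)) (- z)) (fun _ _ _ => lexx _).
  by apply: cone_idealM zM xb => s t st; rewrite edge_formN (bd s t st) addrCA addNr addr0.
have zM := proj2 (cone_ideal_monomial (fun s t => edge_form s t z) z) (fun _ _ _ => lexx _).
by apply: cone_idealM zM xd => s t st; rewrite (bd s t st) addrC.
Qed.

End ConeIdeals.

(** * Every divisor class comes from edge valuations *)

Lemma int_set_min (S : set int) k0 : (exists k, S k) -> (forall k, S k -> k0 <= k) ->
  exists2 k, S k & forall l, S l -> k <= l.
Proof.
move=> [k Sk] S0; pose T n := `[< S (k0 + n%:Z) >].
have TE l : S l -> exists2 n : nat, T n & l = k0 + n%:Z.
  move=> Sl; exists `|l - k0|%N; last by rewrite gez0_abs ?subr_ge0 ?S0 // addrCA subrr addr0.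
  by apply/asboolP; rewrite gez0_abs ?subr_ge0 ?S0 // addrCA subrr addr0.
have [n /asboolP Tn nmin] : exists2 n, T n & forall m, T m -> (n <= m)%N.
  have exT : exists n, T n by have [n Tn _] := TE k Sk; exists n.
  by have [n Tn nmin] := ex_minnP exT; exists n.
by exists (k0 + n%:Z) => // l /TE[m /nmin nm ->]; rewrite lerD2l lez_nat.
Qed.

Section Embedding.
Import mpoly monalg.
Variables (K : fieldType) (disp : Order.disp_t) (P : finPOrderType disp).
Local Notation R := (join_meet_ring K P).
Local Notation M := {ffun option P -> int}.
Local Notation N := #|{: option P}|.
Local Notation Q := (mpoly.mpoly N K).
Implicit Types (f g : R) (a c m : cone_point P) (p q : Q).

Local Notation mon a := (mpoly_monomial K a).

Lemma to_mpolyD f g : to_mpoly (f + g) = to_mpoly f + to_mpoly g.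
Proof. exact: mmapD. Qed.

Lemma to_mpoly0 : to_mpoly (0 : R) = 0.
Proof. exact: mmap0. Qed.

Lemma to_mpoly_inj : injective (@to_mpoly K disp P).
Proof.
move=> f g fg; apply/eqP; rewrite -subr_eq0; apply/eqP/to_mpoly_eq0.
by apply: (addIr (to_mpoly g)); rewrite -to_mpolyD subrK add0r.
Qed.

Lemma to_mpoly_term k a : to_mpoly (<< k *g a >> : R) = mpoly.mpolyC N k * mon a.
Proof. exact: mmapU. Qed.

Lemma to_mpoly_monomial a : to_mpoly (monomial K a) = mon a.
Proof. by rewrite to_mpoly_term mpoly.mpolyC1 mul1r. Qed.

Lemma mpoly_monomialM a c : mon (cone_mul a c) = mon a * mon c.
Proof. by rewrite -!to_mpoly_monomial -to_mpolyM -monomialM. Qed.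

Lemma mpoly_monomial_neq0 a : mon a != 0.
Proof.
apply: contraNneq (monomial_neq0 K a) => a0; apply/eqP/to_mpoly_eq0.
by rewrite to_mpoly_monomial.
Qed.

Lemma mpoly_exponent_shift (m : mpoly.multinom N) :
  exists a c, mpoly_exponent a = mpoly.mnm_add m (mpoly_exponent c).
Proof.
pose z : M := [ffun i => (mpoly.fun_of_multinom m (enum_rank i))%:Z].
have [[a c] /= az] := cone_difference z; exists a, c.
apply/mpoly.mnmP => i; rewrite mpoly.mnmDE !mpoly_exponentE az !ffunE.
apply/eqP; rewrite -eqz_nat PoszD enum_valK !gez0_abs ?addr_ge0 //.
all: by rewrite in_cone_ge0 ?exponent_cone.
Qed.

(** Together with the injectivity of [to_mpoly], this says that the ring and the
polynomial ring become equal once the monomials are inverted. *)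
Lemma to_mpoly_localization q : exists f a, to_mpoly f = q * mon a.
Proof.
elim/mpoly.mpolyind: q => [|k m q _ _ [f [a fE]]].
  by exists 0, (cone_one P); rewrite mul0r to_mpoly0.
have [a' [c mE]] := mpoly_exponent_shift m.
exists (<< k *g cone_mul a' a >> + f * monomial K c), (cone_mul c a).
rewrite to_mpolyD to_mpoly_term to_mpolyM to_mpoly_monomial fE.
rewrite !mpoly_monomialM mulrDl; congr (_ + _); last by rewrite -mulrA [mon a * _]mulrC.
have -> : mon a' = mpoly.mpolyX K m * mon c.
  by rewrite /mpoly_monomial mE mpoly.mpolyXD.
by rewrite -mpoly.mul_mpolyC -!mulrA.
Qed.
End Embedding.

Section LocalizedDivisibility.
Variables (A B : comNzRingType) (psi : A -> B).
Hypothesis psi_inj : injective psi.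
Hypothesis psiM : forall f g, psi (f * g) = psi f * psi g.
Implicit Types (a c f p r s : A) (e q t : B).

Lemma localized_divides a c f r s e q : psi f = q * e -> psi r = e * psi a ->
  psi s = q * psi c -> a * c * f = s * r.
Proof.
move=> fE rE sE; apply: psi_inj; rewrite !psiM fE rE sE [RHS]mulrACA mulrC.
by rewrite [psi a * _]mulrC.
Qed.

Lemma localized_divides_mul a c d p r s e t : psi r = e * psi a ->
  psi s = t * psi c -> psi p * e = t * psi d -> c * (p * r) = s * a * d.
Proof.
move=> rE sE pE; apply: psi_inj.
by rewrite !psiM rE sE [psi p * _]mulrA pE !mulrA [psi c * t]mulrC mulrAC.
Qed.
End LocalizedDivisibility.

Section Divisorial.
Import mpoly monalg.
Variables (K : fieldType) (disp : Order.disp_t) (P : finPOrderType disp).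
Local Notation R := (join_meet_ring K P).
Local Notation F := {fraction R}.
Local Notation M := {ffun option P -> int}.
Implicit Types (f g : R) (a c m : cone_point P) (x y h : F) (z u : M).
Implicit Types (s t : hat P) (b d : hat P -> hat P -> int).

Local Notation X a := ((monomial K a)%:F : F).
Local Notation v s t := (val_at (@edge_form disp P int s t)).
Local Notation edgeD := (@edge_formD disp P int).

(** The Laurent polynomial ring is a localization of a polynomial ring, so
every set of its elements has a gcd; this is the corresponding statement for
bounded sets of fractions. *)
Lemma laurent_gcd (S : set F) : vbounded S -> exists g : F, [/\ g != 0,
  forall x, S x -> laurent (x / g) &
  forall h, (forall x, S x -> in_base (h * x)) -> laurent (h * g)].
Proof.
move=> [[x0 Sx0 x00] [d d0 dS]].
have [e eS] := @mpoly_has_gcds K _ [set q | exists2 f : R, to_mpoly f = q &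
  exists2 x, S x & d%:F * x = f%:F].
have [r [a rE]] := to_mpoly_localization e.
have rneq0 : r != 0.
  have [f fE] := dS x0 Sx0; have f0 : f != 0.
    by rewrite -tofrac_eq0 -fE mulf_neq0 ?tofrac_eq0.
  have [q qE] : divides e (to_mpoly f) by apply: (gcd_dvd eS); exists f => //; exists x0.
  apply: contraNneq f0 => r0; apply/eqP/to_mpoly_inj.
  have : e * mpoly_monomial K a = 0 by rewrite -rE r0 to_mpoly0.
  move=> /eqP; rewrite mulf_eq0 (negbTE (mpoly_monomial_neq0 K a)) orbF => /eqP e0.
  by rewrite qE e0 mulr0 to_mpoly0.
have dF0 : d%:F != 0 :> F by rewrite tofrac_eq0.
have rF0 : r%:F != 0 :> F by rewrite tofrac_eq0.
exists (r%:F / d%:F); split=> [|x Sx|h hS].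
- exact: mulf_neq0 rF0 (invr_neq0 dF0).
- have [f fE] := dS x Sx.
  have [q qE] : divides e (to_mpoly f) by apply: (gcd_dvd eS); exists f => //; exists x.
  have [q' [c q'E]] := to_mpoly_localization q.
  have key : monomial K (cone_mul a c) * f = q' * r.
    rewrite monomialM.
    apply: (localized_divides (@to_mpoly_inj K disp P) (@to_mpolyM K disp P) qE);
      rewrite to_mpoly_monomial; [exact: rE | exact: q'E].
  by exists (cone_mul a c), q'; exact: fraction_scaled_div fE key.
have [p [q [q0 hE]]] := fraction_form h.
have [t tE] : divides (to_mpoly (q * d)) (to_mpoly p * e).
  apply: (divides_gcdM (@mpoly_has_gcds K _) eS) => _ [f <- [x Sx fE]].
  have [f' f'E] := hS x Sx; exists (to_mpoly f').
  rewrite -[LHS](to_mpolyM p f) -[RHS](to_mpolyM f' (q * d)).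
  by apply: (congr1 (@to_mpoly K disp P)); apply: fraction_scaled_mul fE _; rewrite -?hE.
have [t' [c t'E]] := to_mpoly_localization t.
have key : monomial K c * (p * r) = t' * monomial K a * (q * d).
  apply: (localized_divides_mul (@to_mpoly_inj K disp P) (@to_mpolyM K disp P) _ _ tE);
    rewrite to_mpoly_monomial; [exact: rE | exact: t'E].
exists c, (t' * monomial K a); rewrite hE.
exact: fraction_mul_eq key.
Qed.

Let vM s t x y : x != 0 -> y != 0 -> v s t (x * y) = v s t x + v s t y.
Proof. exact: val_atM (edgeD s t) _ _. Qed.

Lemma in_base_val_ge0 x s t : hasse s t -> in_base x -> x != 0 -> 0 <= v s t x.
Proof. by move=> st /in_base_cone_ideal[_ xv] /xv; exact. Qed.

(** After division by a gcd [g] in the Laurent polynomial ring, a divisorial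
ideal is cut out by the least values that the edge valuations take on it. *)
Lemma divisorial_cone_ideal (I : set F) : divisorial I ->
  exists2 g : F, g != 0 & exists b, I = fscale g (cone_ideal b).
Proof.
move=> [/fractional_vbounded Ib Iv]; have [g [g0 gI Ig]] := laurent_gcd Ib.
have [[x0 Ix0 x00] [d d0 dI]] := Ib.
have dF0 : d%:F != 0 :> F by rewrite tofrac_eq0.
have g'0 := invr_neq0 g0.
have xg0 x : x != 0 -> x / g != 0 by move=> x_0; exact: (mulf_neq0 x_0 g'0).
have bst s t : exists k, hasse s t -> (exists x, [/\ I x, x != 0 & k = v s t (x / g)]) /\
    forall x, I x -> x != 0 -> k <= v s t (x / g).
  have [st|] := boolP (hasse s t); last by exists 0.
  pose V := [set k | exists x, [/\ I x, x != 0 & k = v s t (x / g)]].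
  have [||k Vk kmin] := @int_set_min V (v s t g^-1 - v s t d%:F).
  - by exists (v s t (x0 / g)), x0.
  - move=> _ [x [Ix xn0 ->]]; rewrite (vM _ _ xn0 g'0) addrC lerD2r.
    have := in_base_val_ge0 st (dI x Ix) (mulf_neq0 dF0 xn0).
    by rewrite (vM _ _ dF0 xn0) addrC -lerBlDr sub0r.
  exists k => _; split=> [|x Ix xn0]; first exact: Vk.
  by apply: kmin; exists x.
have /choice[b bP] s : exists bs : hat P -> int, forall t, hasse s t ->
    (exists x, [/\ I x, x != 0 & bs t = v s t (x / g)]) /\
    forall x, I x -> x != 0 -> bs t <= v s t (x / g).
  by have [bs] := choice (bst s); exists bs.
have xgb x : I x -> cone_ideal b (x / g).
  move=> Ix; split; first exact: gI.
  move=> xgn0 s t st; have [_ h] := bP s t st; apply: (h x Ix).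
  by apply: contraNneq xgn0 => ->; rewrite mul0r.
exists g; first exact: g0.
exists b; rewrite -[LHS]Iv -[cone_ideal b]vclosure_cone_ideal -(vclosure_fscale _ g0).
apply: (congr1 (@finv R)); rewrite (finv_fscale _ g0) finv_cone_ideal.
apply/seteqP; split=> h => [hI|/(fscaleV_mem _ _ g0) hb x Ix]; last first.
  apply/in_base_cone_ideal; rewrite -(mulf_divK h x g0).
  by apply: cone_idealM hb (xgb x Ix) => s t _; rewrite addNr.
apply/(fscaleV_mem _ _ g0); split; first exact: (Ig h hI).
move=> hgn0 s t st; have [[x [Ix xn0 ->]] _] := bP s t st.
have hn0 : h != 0 by apply: contraNneq hgn0 => ->; rewrite mul0r.
rewrite -subr_ge0 opprK -(vM _ _ hgn0 (xg0 x xn0)) (mulf_divK h x g0).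
exact: in_base_val_ge0 st (hI x Ix) (mulf_neq0 hn0 xn0).
Qed.

Lemma class_cone (k : class_group R) : exists b, k = cone_class K b.
Proof.
elim/quotW: k => I; have [g g0 [b IE]] := divisorial_cone_ideal (ideal_ofP I).
by exists b; apply/eqP/divisor_classP; exists g.
Qed.

Lemma canonical_supp f m : canonical_ideal f -> m \in msupp f -> in_interior (exponent m).
Proof.
move=> fI; move: m; move: f fI; apply: ideal_generated_sub => [m|f g fi gi m|f _ [a Ia <-] m].
- by rewrite msupp0.
- by move=> /(fsubsetP (msuppD_le _ _)); rewrite in_fsetU => /orP[/fi|/gi].
move=> /suppM[c [c' [_ ]]]; rewrite supp_monomial => /eqP -> -> /=.
apply/in_interiorP => s t st; rewrite edge_formD ltr_wpDl //.
  exact: (in_coneP _ (exponent_cone c)).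
exact: (in_interiorP _ Ia).
Qed.

Lemma monomial_canonical a : in_interior (exponent a) -> canonical_ideal (monomial K a).
Proof.
by exists 1%N, (fun=> 1), (fun=> monomial K a); split=> [_|]; [exists a | rewrite big_ord1 mul1r].
Qed.

Lemma canonical_classE : canonical_class K P = cone_class K (fun _ _ : hat P => 1).
Proof.
congr divisor_class; apply: divisor_inj => /=.
rewrite -[RHS]vclosure_cone_ideal /vclosure; apply: (congr1 (@finv R)).
rewrite finv_cone_ideal; apply/seteqP; split=> [x xI|x x1 _ [w wI <-]].
  rewrite -(@eq_cone_ideal K _ _ (fun s t => 0 - 1)) => [|s t _]; last exact: sub0r.
  apply: (@cone_ideal_colon _ _ _ (fun s t => 1)) => z z1; apply/in_base_cone_ideal.
  have Iz : in_interior z by apply/in_interiorP => s t /z1; rewrite gtz0_ge1.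
  apply: xI; exists (monomial K (ConePoint (in_interior_cone Iz))).
    exact: monomial_canonical.
  by rewrite -laurent_monomial_exponent.
apply/in_base_cone_ideal.
have w1 : cone_ideal (fun _ _ => 1) (w%:F : F).
  split=> [|w0 s t st]; first exact/in_base_laurent/in_base_tofrac.
  have wn0 : w != 0 by rewrite -tofrac_eq0.
  have [k wk] := is_order_exists (@edge_form _ P int s t) wn0.
  rewrite (val_tofrac (edgeD s t) wk); have [_ [m mw <-]] := wk.
  by rewrite -gtz0_ge1; exact: (in_interiorP _ (canonical_supp wI mw)).
by apply: cone_idealM x1 w1 => s t _; rewrite addNr.
Qed.
End Divisorial.

(** * A basis of the class group *)

Section Tree.
Variables (disp : Order.disp_t) (P : finPOrderType disp).
Local Notation M := {ffun option P -> int}.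
Implicit Types (s t : hat P) (z : M) (b : hat P -> hat P -> int).

(** The edges [(t, succ t)] form a spanning tree of the Hasse diagram, rooted at the
top. *)
Definition succ t : hat P := if [pick y | hasse t y] is Some y then y else t.

Lemma hasse_succ t : t != Top P -> hasse t (succ t).
Proof.
move=> /eqP/hasse_exists[y ty]; rewrite /succ; case: pickP => // /(_ y).
by rewrite ty.
Qed.

Lemma hasse_neq_top s t : hasse s t -> s != Top P.
Proof. by move=> /andP[st _]; apply: contraTneq st => ->. Qed.

Lemma hasse_neq_bot s t : hasse s t -> t != Bot P.
Proof. by move=> /andP[st _]; apply: contraTneq st => ->; case: s. Qed.

Lemma succ_top : succ (Top P) = Top P.
Proof. by rewrite /succ; case: pickP => // y /hasse_neq_top; rewrite eqxx. Qed.

Lemma up_succ t : t != Top P -> (up (succ t) < up t)%N.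
Proof. by move=> /hasse_succ/andP[/up_lt]. Qed.

Lemma succ_ind (Q : hat P -> Prop) : Q (Top P) ->
  (forall t, t != Top P -> Q (succ t) -> Q t) -> forall t, Q t.
Proof.
move=> QT Qs t; have [n] := ubnP (up t); elim: n t => // n IHn t tn.
have [->//|tT] := eqVneq t (Top P).
by apply: Qs => //; apply: IHn; apply: leq_trans (up_succ tT) _.
Qed.

(** Values prescribed on the tree are realized by summing them along the path from a
vertex to the top. *)
Lemma tree_function b : exists h : hat P -> int,
  forall t, t != Top P -> h t - h (succ t) = b t (succ t).
Proof.
have iter_succ n t : (up t <= n)%N -> iter n succ t = Top P.
  elim: n t => [|n IHn] t tn.
    apply/eqP; apply: contraLR tn => /up_succ; rewrite -ltnNge; exact: leq_trans.
  rewrite iterSr; apply: IHn; have [->|tT] := eqVneq t (Top P).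
    by rewrite succ_top /up eq_card0 //; case.
  by rewrite -ltnS; apply: leq_trans (up_succ tT) tn.
pose c t := if t == Top P then 0 else b t (succ t).
pose N := #|{: hat P}|.
(* The path has at most [N] steps; [c] vanishes at the top, so it may be prolonged
   there without changing the sum. *)
exists (fun t => \sum_(i < N) c (iter i succ t)) => t tT.
have -> : \sum_(i < N) c (iter i succ t) = c t + \sum_(i < N) c (iter i succ (succ t)).
  transitivity (\sum_(i < N.+1) c (iter i succ t)).
    by rewrite big_ord_recr /= iter_succ ?max_card // /c eqxx addr0.
  rewrite big_ord_recl /=; congr (_ + _); apply: eq_bigr => i _.
  by rewrite -iterS iterSr.
by rewrite addrK /c (negbTE tT).
Qed.

Lemma tree_point b : exists z : M,
  forall t, t != Top P -> edge_form t (succ t) z = b t (succ t).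
Proof.
have [h hE] := tree_function b; exists (point_of h) => t /hE.
by rewrite edge_form_point_of.
Qed.

Lemma tree_point_unique z : (forall t, t != Top P -> edge_form t (succ t) z = 0) ->
  forall s t, edge_form s t z = 0.
Proof.
move=> z0; have c0 : forall t, hat_coord z t = 0.
  apply: succ_ind => // t /z0 /eqP; rewrite subr_eq0 => /eqP -> //.
by move=> s t; rewrite /edge_form !c0 subrr.
Qed.
End Tree.

Section FreeClassGroup.
Variables (K : fieldType) (disp : Order.disp_t) (P : finPOrderType disp).
Implicit Types (s t : hat P) (b d : hat P -> hat P -> int).

Lemma eq_cone_class b d : (forall s t, hasse s t -> b s t = d s t) ->
  cone_class K b = cone_class K d.
Proof.
by move=> bd; congr divisor_class; apply: divisor_inj; exact: eq_cone_ideal.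
Qed.

Definition off_tree (e : hat P * hat P) := hasse e.1 e.2 && (e.2 != succ e.1).
Local Notation E := {e : hat P * hat P | off_tree e}.
Local Notation n := #|{: E}|.

Definition off_tree_value (u : 'rV[int]_n) s t : int :=
  if insub (s, t) : option E is Some e then u 0 (enum_rank e) else 0.

Lemma off_tree_value_tree u s : off_tree_value u s (succ s) = 0.
Proof. by rewrite /off_tree_value insubF // /off_tree /= eqxx andbF. Qed.

Lemma off_tree_valueE u (i : 'I_n) :
  off_tree_value u (val (enum_val i)).1 (val (enum_val i)).2 = u 0 i.
Proof. by rewrite /off_tree_value -surjective_pairing valK enum_valK. Qed.

Definition off_tree_class u : class_group (join_meet_ring K P) :=
  cone_class K (off_tree_value u).

Lemma off_tree_class_additive : nmod_morphism off_tree_class.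
Proof.
split=> [|u v]; rewrite /off_tree_class.
  rewrite -(cone_class0 K P); apply: eq_cone_class => s t _.
  by rewrite /off_tree_value; case: insub => // e; rewrite mxE.
rewrite -cone_classD; apply: eq_cone_class => s t _.
by rewrite /off_tree_value; case: insub => [e|]; rewrite ?mxE ?addr0.
Qed.

(** A lattice point whose edge forms vanish on the tree is zero. *)
Lemma off_tree_class_inj : injective off_tree_class.
Proof.
move=> u v /cone_class_eq[z zE]; apply/rowP => i.
have z0 : forall s t, edge_form s t z = 0.
  apply: tree_point_unique => t /hasse_succ/zE.
  by rewrite !off_tree_value_tree add0r.
have /andP[hi _] := valP (enum_val i).
by rewrite -!off_tree_valueE zE // z0 addr0.
Qed.

(** A suitable lattice point makes a family of bounds vanish on the tree. *)
Lemma off_tree_class_surj k : exists u, off_tree_class u = k.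
Proof.
have [b ->] := class_cone k; have [z zE] := tree_point b.
exists (\row_i (b (val (enum_val i)).1 (val (enum_val i)).2 -
  edge_form (val (enum_val i)).1 (val (enum_val i)).2 z)).
apply/cone_class_eq; exists (- z) => s t st; rewrite edge_formN.
rewrite /off_tree_value; case: insubP => [e _ eE|]; first by rewrite mxE enum_rankK eE.
rewrite /off_tree st /= negbK => /eqP ->.
by rewrite zE ?subrr // (hasse_neq_top st).
Qed.
End FreeClassGroup.

(** * Nearly Gorenstein rings *)

Lemma isomorphic_principal (A : idomainType) (x : A) (I : set A) : x != 0 ->
  (forall y, I y <-> exists r, y = x * r) -> isomorphic_to_ring I.
Proof.
move=> x0 IE; pose f (r : A^o) : A^o := x * r.
have flin : linear f.
  by move=> a u v; rewrite /f [x * (_ + _)]mulrDr; congr (_ + _); exact: mulrCA.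
pose fL : {linear A^o -> A^o} := HB.pack f (GRing.isLinear.Build _ _ _ _ f flin).
exists fL; split=> [u v /= /(mulfI x0)//|].
by apply/seteqP; split=> [_ [r _ <-]|y /IE[r ->]]; [apply/IE; exists r | exists r].
Qed.

Section Trace.
Variables (K : fieldType) (disp : Order.disp_t) (P : finPOrderType disp).
Local Notation R := (join_meet_ring K P).
Local Notation M := {ffun option P -> int}.
Implicit Types (f g w : R) (a c m : cone_point P) (z : M) (s t : hat P).

Lemma hom_on_mul (A : comNzRingType) (I : set A) phi (r u : A) :
  I 0 -> I u -> hom_on I phi -> phi (r * u) = r * phi u.
Proof.
move=> I0 Iu phiI; have phi0 : phi 0 = 0.
  have := phiI 1 0 0 I0 I0; rewrite mul1r addr0 mul1r => /eqP.
  by rewrite addrC -subr_eq subrr eq_sym => /eqP.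
by have := phiI r u 0 Iu I0; rewrite !addr0 phi0 addr0.
Qed.

Lemma hom_on_comm (A : comNzRingType) (I : set A) phi (u v : A) :
  I 0 -> I u -> I v -> hom_on I phi -> u * phi v = v * phi u.
Proof.
by move=> I0 Iu Iv h; rewrite -(hom_on_mul u I0 Iv h) -(hom_on_mul v I0 Iu h) mulrC.
Qed.

Lemma canonical_ideal0 : canonical_ideal (0 : R).
Proof.
by exists 0%N, (fun=> 0), (fun=> 0); split; [case | rewrite big_ord0].
Qed.

(** A homomorphism from the canonical ideal to the ring is multiplication by a
fraction, and the exponents of that fraction are at least [-1] on every edge,
because for each edge some monomial of the canonical ideal is [1] on it. *)
Lemma hom_on_canonical phi c m : hom_on (@canonical_ideal K _ P) phi ->
  in_interior (exponent c) -> m \in msupp (phi (monomial K c)) ->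
  forall s t, hasse s t -> -1 <= edge_form s t (exponent m - exponent c).
Proof.
move=> phiI Ic mphi s t st.
have [y [yst y1]] := tight_point (fun _ _ => 1) st.
have Iy : in_interior y by apply/in_interiorP => s' t' /y1; rewrite gtz0_ge1.
pose q := ConePoint (in_interior_cone Iy).
have e : monomial K q * phi (monomial K c) = monomial K c * phi (monomial K q).
  have qI : canonical_ideal (monomial K q) by exact: monomial_canonical.
  exact: hom_on_comm canonical_ideal0 qI (monomial_canonical K Ic) phiI.
have phin0 : phi (monomial K c) != 0 by apply: contraTneq mphi => ->; rewrite msupp0.
have [k kphi] := is_order_exists (@edge_form _ P int s t) phin0.
have [_ [n nphi nE]] := is_orderM (@edge_formD _ P int s t) (is_order_monomial K _ q) kphi.
move: nphi; rewrite e => /suppM[c' [n' [+ _ nE']]].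
rewrite supp_monomial => /eqP c'E; move: nE; rewrite nE' /= c'E edge_formD yst => nE.
have n'0 : 0 <= edge_form s t (exponent n') by exact: (in_coneP _ (exponent_cone n')).
have mk : k <= edge_form s t (exponent m) by exact: (proj1 kphi).
rewrite edge_formD edge_formN lerBrDl; apply: le_trans _ mk.
by rewrite lerBlDr [k + 1]addrC -nE lerDl.
Qed.

(** The trace is spanned by the products of an element of the canonical ideal and a
fraction as in [hom_on_canonical]; after multiplication by the monomial of a fixed
interior point [c] these fractions become elements of the ring. *)
Lemma trace_monomial a : trace_ideal (@canonical_ideal K _ P) (monomial K a) ->
  exists z z', [/\ exponent a = z + z', in_interior z' &
    forall s t, hasse s t -> -1 <= edge_form s t z].
Proof.
move=> [k [phi [w [phiw aE]]]].
have Iup := up_point_interior P int.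
pose c := ConePoint (in_interior_cone Iup).
have cI : canonical_ideal (monomial K c) by exact: monomial_canonical.
have caE : monomial K (cone_mul c a) = \sum_i w i * phi i (monomial K c).
  rewrite monomialM aE mulr_sumr; apply: eq_bigr => i _.
  have [phii wi] := phiw i; exact: hom_on_comm canonical_ideal0 cI wi phii.
have [i] : exists i, cone_mul c a \in msupp (w i * phi i (monomial K c)).
  apply: contrapT => /forallNP none.
  have : (monomial K (cone_mul c a))@_(cone_mul c a) = 0.
    rewrite caE raddf_sum big1 // => i _; apply: mcoeff_outdom.
    exact/negP/none.
  by rewrite /monomial mcoeffU eqxx => /eqP; rewrite oner_eq0.
move=> /suppM[b' [m [b'w mphi cabm]]]; have [phii wi] := phiw i.
exists (exponent m - exponent c), (exponent b'); split.
- have := congr1 (@exponent _ _) cabm => /= /(congr1 (fun z => z - exponent c)).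
  by rewrite addrAC subrr add0r => ->; rewrite [RHS]addrC addrA.
- exact: canonical_supp wi b'w.
exact: (@hom_on_canonical (phi i) c m phii Iup mphi).
Qed.

(** An exponent vector is interior exactly when it lies in [z] plus the cone, so the
monomial with exponent [z] generates the canonical ideal. *)
Lemma unimodular_gorenstein z :
  (forall s t, hasse s t -> edge_form s t z = 1) -> gorenstein K P.
Proof.
move=> z1; have Iz : in_interior z by apply/in_interiorP => s t /z1 ->.
pose q := ConePoint (in_interior_cone Iz).
apply: (@isomorphic_principal _ (monomial K q)) => [|y]; first exact: monomial_neq0.
split=> [yI|[r ->]]; last first.
  exists 1%N, (fun=> r), (fun=> monomial K q); split=> [_|]; first by exists q.
  by rewrite big_ord1 mulrC.
apply: monomial_dvd => m my; apply/in_coneP => s t st.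
rewrite edge_formD edge_formN (z1 s t st) subr_ge0 -gtz0_ge1.
exact: (in_interiorP _ (canonical_supp yI my)).
Qed.

(** The point is the interior summand in a decomposition, as in [trace_monomial], of the
exponent [u0] that is [1] at the bottom and [0] elsewhere: the two summands have values
at least [-1] and at least [1] on each edge, and their sum is [1] on the edges from the
bottom and [0] on the others. *)
Lemma nearly_gorenstein_point : nearly_gorenstein K P ->
  exists z, (forall s t, hasse s t -> s != Bot P -> edge_form s t z = 1) /\
    forall t, hasse (Bot P) t -> edge_form (Bot P) t z = 1 \/ edge_form (Bot P) t z = 2.
Proof.
move=> ng; pose u0 : M := point_of (fun s => (s == Bot P)%:R).
have u0E s t : hasse s t -> edge_form s t u0 = (s == Bot P)%:R.
  by move=> /hasse_neq_bot/negbTE t0; rewrite edge_form_point_of t0 subr0.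
have Cu : in_cone u0 by apply/in_coneP => s t /u0E ->; exact: ler0n.
have [|z [z' [uE Iz' z1]]] := @trace_monomial (ConePoint Cu).
  apply: ng; exists 1%N, (fun=> 1), (fun=> monomial K (ConePoint Cu)).
  split=> [_|]; last by rewrite big_ord1 mul1r.
  by exists (ConePoint Cu) => //=; rewrite ffunE eqxx subr0.
have z'1 s t : hasse s t -> 1 <= edge_form s t z' <= 1 + (s == Bot P)%:R.
  move=> st; rewrite -gtz0_ge1 (in_interiorP _ Iz') //=.
  by rewrite -(u0E s t st) (_ : u0 = z + z') // edge_formD addrA lerDr -lerBlDl sub0r z1.
exists z'; split=> [s t st /negbTE s0|t st].
  by have := z'1 s t st; rewrite s0 addr0 -eq_le => /eqP.
have := z'1 _ _ st; rewrite eqxx => /andP[]; rewrite [1 <= _]le_eqVlt => /orP[/eqP <-|]; first by left.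
rewrite -lezD1 => h1 h2; right; by apply/eqP; rewrite eq_le h1 h2.
Qed.

(** If the canonical class were a proper multiple, then some lattice point would
have a value congruent to [1] on every edge; away from the bottom it would be
congruent to the point [z] of [nearly_gorenstein_point], and the edges from the
bottom, on which [z] takes both values [1] and [2], would force the modulus to
divide [1]. *)
Lemma canonical_class_primitive (k : int) b : nearly_gorenstein K P ->
  ~ gorenstein K P ->
  canonical_class K P = cone_class K (fun s t => k * b s t) -> k \is a GRing.unit.
Proof.
move=> /nearly_gorenstein_point[z [z1 z12]] ngor.
rewrite canonical_classE => /cone_class_eq[y yE].
have oneE s t : hasse s t -> 1 - edge_form s t y = k * b s t.
  by move=> /yE /= e; rewrite [X in X - _]e addrK.
have [p hp p1] : exists2 p, hasse (Bot P) p & edge_form (Bot P) p z = 1.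
  apply: contrapT => no1; apply: ngor.
  apply: (@unimodular_gorenstein (z - point_of (fun s => (s == Bot P)%:R))) => s t st.
  rewrite edge_formD edge_formN edge_form_point_of (negbTE (hasse_neq_bot st)) subr0.
  have [sB|s0] := eqVneq s (Bot P); last by rewrite z1 // subr0.
  move: st; rewrite sB => st; case: (z12 t st) => [z_1|-> //].
  by case: no1; exists t.
have [q hq q2] : exists2 q, hasse (Bot P) q & edge_form (Bot P) q z = 2.
  apply: contrapT => no2; apply: ngor; apply: (@unimodular_gorenstein z) => s t st.
  have [sB|s0] := eqVneq s (Bot P); last exact: z1.
  move: st; rewrite sB => st; case: (z12 t st) => // z_2.
  by case: no2; exists t.
pose D t := hat_coord (z - y) t.
have DE s t : D s = edge_form s t z - edge_form s t y + D t.
  by rewrite -edge_formN -edge_formD /edge_form subrK.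
have kD : forall t, t != Bot P -> (k %| D t)%Z.
  apply: (@succ_ind _ P (fun t => t != Bot P -> (k %| D t)%Z)) => [_|t tT IHt t0].
    exact: dvdz0.
  have st := hasse_succ tT; rewrite (DE t (succ t)) (z1 _ _ st t0) (oneE _ _ st).
  by rewrite rpredD ?dvdz_mulr ?IHt ?(hasse_neq_bot st).
have kB1 : (k %| D (Bot P))%Z.
  rewrite (DE _ p) p1 (oneE _ _ hp).
  by rewrite rpredD ?dvdz_mulr ?kD ?(hasse_neq_bot hp).
have : (k %| D (Bot P) - D q - (1 - edge_form (Bot P) q y))%Z.
  rewrite (oneE _ _ hq); apply: rpredB; last exact: dvdz_mulr.
  by apply: rpredB => //; apply: kD; exact: hasse_neq_bot hq.
have -> : D (Bot P) - D q - (1 - edge_form (Bot P) q y) = 1.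
  by rewrite (DE (Bot P) q) q2 addrK; move: (edge_form _ q y) => e; rewrite opprB subrKA.
by rewrite dvdz1; clear; case: k => [[|[|n]]|[|n]].
Qed.
End Trace.

Theorem corollary3p3 (K : fieldType) (disp : Order.disp_t)
    (P : finPOrderType disp) :
  (0 < #|P|)%N ->
  nearly_gorenstein K P -> ~ gorenstein K P ->
  torsion_number (canonical_class K P) = 1%N.
Proof.
move=> _ ng ngor.
pose n := #|{: {e : hat P * hat P | off_tree e}}|.
pose f : {additive 'rV[int]_n -> class_group (join_meet_ring K P)} :=
  HB.pack (@off_tree_class K _ P)
    (GRing.isNmodMorphism.Build _ _ _ (@off_tree_class_additive K _ P)).
apply: (@torsion_number_primitive _ _ _ f).
- exact: off_tree_class_inj.
- exact: off_tree_class_surj.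
move=> k u kuE; apply: (canonical_class_primitive (b := off_tree_value u) ng ngor).
rewrite -kuE; apply: eq_cone_class => s t _; rewrite /off_tree_value.
by case: insub => [e|]; rewrite ?mxE ?mulr0.
Qed.
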